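(* Let $p=p_n$, $s=s_n$ be sequences and $\lambda_n>0$ a sequence, as $n\to\infty$. (i) If $s^2\log^2(p)\wedge p\prec n$ and $\lambda_n\prec\frac{s\log(p)}{n}\wedge\frac{p^{1/2}}{n}$, then, for general single index models (SIM), any test fails to separate asymptotically the null hypothesis $\beta=0$ from the alternative that $\beta$ has at most $s$ nonzero entries and the generalized signal-to-noise ratio is at least $\lambda_n$. (ii) If $\lambda_n\prec\frac{s\log(p)}{n}\wedge\frac{p^{1/2}}{n}\wedge\frac1{\sqrt n}$, then, for single index models with additive noise (SIMa), any test fails to separate asymptotically the null hypothesis $\beta=0$ from the alternative that $\beta$ has at most $s$ nonzero entries and the generalized signal-to-noise ratio is at least $\lambda_n$.
   Context: Asymptotic notation: for positive sequences, $a_n\prec b_n$ means $a_n=o(b_n)$; $a\wedge b=\min\{a,b\}$. SIM: $y=f(\beta^{\tau}x,\epsilon)$, $x\sim N(0,\Sigma)$ in $\mathbb{R}^p$, $\epsilon\sim N(0,\sigma^2)$ independent of $x$, $f$ an unknown function. SIMa: $y=f(\beta^{\tau}x)+\epsilon$ with the same $x,\epsilon$. In both, there are fixed constants $0<C_{\min}<C_{\max}$ with $C_{\min}<\lambda_{\min}(\Sigma)\le\lambda_{\max}(\Sigma)<C_{\max}$. The link $f$ is unknown, so under the alternative $\beta$ is normalized by $\|\beta\|_2=1$. The generalized signal-to-noise ratio (gSNR) of a model is $\lambda=\lambda_{\max}(\mathrm{var}(\mathbb{E}[x\mid y]))$. Under the null hypothesis $\beta=0$, $y$ is independent of $x$ and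 gSNR $=0$. The data are $n$ i.i.d. copies $(y_i,x_i)$. Linear models $y=\kappa\beta^{\tau}x+\epsilon$ are special cases of SIMa, which are special cases of SIM. A test is a measurable $\{0,1\}$-valued function $\phi_n$ of the data. ''Any test fails to separate the null and the alternative asymptotically'' means: there is no sequence of tests $\phi_n$ for which the type I error, $\sup_{H_0}\mathbb{E}(\phi_n)$, and the type II error, $\sup_{H_a}\mathbb{E}(1-\phi_n)$, both converge to zero, the suprema being over all models of the given type (SIM, resp. SIMa) satisfying the null, resp. the alternative, at sample size $n$. *)

(* Defs.v *)
From HB Require Import structures.
From mathcomp Require Export all_boot all_order all_algebra.
From mathcomp Require Export all_classical all_reals all_analysis.
Set Implicit Arguments.
Unset Strict Implicit.
Unset Printing Implicit Defensive.
Import Order.TTheory GRing.Theory Num.Theory.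
Import numFieldNormedType.Exports.
Local Open Scope classical_set_scope.
Local Open Scope ring_scope.

Section iid.
Context d (T : measurableType d) (R : realType) (P : probability T R).

Definition cons_pair n (u : T * n.-tuple T) : n.+1.-tuple T :=
  [the n.+1.-tuple T of u.1 :: u.2].

Lemma measurable_cons_pair n : measurable_fun setT (@cons_pair n).
Proof. exact: measurable_cons. Qed.

HB.instance Definition _ n :=
  isMeasurableFun.Build _ _ _ _ (@cons_pair n) (@measurable_cons_pair n).

(* The law of n i.i.d. copies, i.e. the n-fold power of P. *)
Fixpoint iid n : probability (n.-tuple T) R :=
  match n with
  | 0%N => \d_ ([tuple] : 0.-tuple T)
  | m.+1 => distribution (P \x iid m)%E (@cons_pair m)
  end.

End iid.

Section cond_exp.
Context d d' (T : measurableType d) (T' : measurableType d') (R : realType).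
Variables (P : probability T R) (Y : T -> T') (X : T -> R).

(* The function m is a version of y |-> E[X | Y = y]. *)
Definition is_cond_exp (m : T' -> R) : Prop :=
  [/\ measurable_fun setT m,
      P.-integrable setT (EFin \o (m \o Y)) &
      forall B : set T', measurable B ->
        (\int[P]_(w in Y @^-1` B) (m (Y w))%:E =
         \int[P]_(w in Y @^-1` B) (X w)%:E)%E].

Definition cond_exp : T' -> R := xget (cst 0) [set m | is_cond_exp m].

End cond_exp.

Section spectrum.
Context (R : realType) (p : nat).

(* Used for symmetric M and p > 0 only: the spectrum is then a nonempty finite
   subset of R, so that sup and inf are the largest and smallest eigenvalues. *)
Definition lambda_max (M : 'M[R]_p) : R := sup [set a | eigenvalue M a].
Definition lambda_min (M : 'M[R]_p) : R := inf [set a | eigenvalue M a].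

End spectrum.

(* The links of general single index models, and, among these, those of single
   index models with additive noise. *)
Definition SIM (R : realType) : set (R * R -> R) :=
  [set f | measurable_fun setT f].
Definition SIMa (R : realType) : set (R * R -> R) :=
  [set f | exists2 g : R -> R, measurable_fun setT g &
                               f = (fun ze => g ze.1 + ze.2)].

Arguments SIM R : clear implicits.
Arguments SIMa R : clear implicits.

Section models.
Context (R : realType) (p : nat).

Definition dot (b : 'rV[R]_p) (x : p.-tuple R) : R :=
  \sum_(i < p) b ord0 i * tnth x i.

Definition l2norm (b : 'rV[R]_p) : R := Num.sqrt (\sum_(i < p) b ord0 i ^+ 2).

Definition nnz (b : 'rV[R]_p) : nat := #|[set i | b ord0 i != 0]%SET|.

Definition apply_mx (A : 'M[R]_p) (z : p.-tuple R) : p.-tuple R :=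
  [tuple dot (row i A) z | i < p].

(* mu = N(0, S): the law of A z, where z has i.i.d. standard normal coordinates
   and A A^T = S. This law does not depend on the choice of the root A. *)
Definition is_mvnormal (S : 'M[R]_p) (mu : probability (p.-tuple R) R) : Prop :=
  exists2 A : 'M[R]_p, A *m A^T = S &
    forall B, measurable B ->
      mu B = pushforward (iid (normal_prob (0 : R) 1) p) (apply_mx A) B.

(* P is the law of (y, x), in this order, where y = f(b^T x, e) with f in F.
   Only Cmin and Cmax are common to all models of the class: the covariance S,
   the noise level sigma and the link f are free parameters. *)
Definition single_index (Cmin Cmax : R) (F : set (R * R -> R)) (b : 'rV[R]_p)
    (P : probability (R * p.-tuple R)%type R) : Prop :=
  exists (S : 'M[R]_p) (mu : probability (p.-tuple R) R) (sigma : R)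
         (f : R * R -> R),
    [/\ is_mvnormal S mu,
        Cmin < lambda_min S /\ lambda_max S < Cmax,
        0 < sigma,
        F f &
        forall B, measurable B ->
          P B = pushforward (mu \x normal_prob (0 : R) sigma)%E
                  (fun xe => (f (dot b xe.1, xe.2), xe.1)) B].

(* lambda_max (var (E[x | y])), computed from the law P of (y, x). *)
Definition gSNR (P : probability (R * p.-tuple R)%type R) : R :=
  let m i y := cond_exp P fst (fun w => tnth w.2 i) y in
  lambda_max (\matrix_(i < p, j < p)
    fine (covariance P (fun w => m i w.1) (fun w => m j w.1))).

Section hypotheses.
Variables (Cmin Cmax : R) (F : set (R * R -> R)).

Definition null_laws : set (probability (R * p.-tuple R)%type R) :=
  [set P | single_index Cmin Cmax F 0 P].

Definition alt_laws (s : nat) (lam : R) :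
    set (probability (R * p.-tuple R)%type R) :=
  [set P | exists b : 'rV[R]_p,
     [/\ l2norm b = 1, (nnz b <= s)%N, single_index Cmin Cmax F b P &
         lam <= gSNR P]].

End hypotheses.

Section errors.
Variables (n : nat) (phi : n.-tuple (R * p.-tuple R)%type -> bool).

(* These are suprema of probabilities; the supremum of the empty set is 0. *)
Definition type1 (H0 : set (probability (R * p.-tuple R)%type R)) : R :=
  sup [set fine 'E_(iid P n)[fun w => (phi w)%:R] | P in H0].
Definition type2 (Ha : set (probability (R * p.-tuple R)%type R)) : R :=
  sup [set fine 'E_(iid P n)[fun w => 1 - (phi w)%:R] | P in Ha].

End errors.

End models.
Arguments null_laws {R} p.
Arguments alt_laws {R} p.

Definition separable (R : realType) (p : nat -> nat)
    (H0 Ha : forall n, set (probability (R * (p n).-tuple R)%type R)) : Prop :=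
  exists phi : forall n, n.-tuple (R * (p n).-tuple R)%type -> bool,
    [/\ forall n, measurable_fun setT (phi n),
        (fun n => type1 (phi n) (H0 n)) @ \oo --> (0 : R) &
        (fun n => type2 (phi n) (Ha n)) @ \oo --> (0 : R)].

(* Main.v *)
From HB Require Import structures.
Require Import Defs.
From mathcomp Require Import measurable_realfun.
From mathcomp Require Import ring lra.
Import Order.TTheory GRing.Theory Num.Theory.
Import numFieldNormedType.Exports.
Set Implicit Arguments.
Unset Strict Implicit.
Unset Printing Implicit Defensive.
Local Open Scope classical_set_scope.
Local Open Scope ring_scope.

(** The link is completely unrestricted, and a wild link fools every test at
    any level of the gSNR below a positive constant.  Cut the range of the first
    coordinate of x into very small cells, and let y = G_j + e on the j-th cell,
    where e ~ N(0, 1) and the levels G_j are drawn i.i.d. from N(0, s^2) with s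
    very large.
    - Averaged over G, a sample none of whose points share a cell is distributed
      exactly as under the null model with noise level sqrt (1 + s^2), and
      collisions are rare.  So for every test there is a typical G with almost
      the same acceptance probability as this null model.
    - For a typical G the levels are far apart compared with e, so that y reveals
      the sign of the first coordinate of x, and the gSNR is bounded below.
    Both classes of models contain these laws, and both rate hypotheses
    force lam_n to tend to 0. *)

(** * Independent samples *)

(** The mixture is exact by Bayes' rule: averaged over its level, a single response from a cell has
    law N(0, 1 + s^2) whatever the cell, and distinct cells have independent levels, so responses
    from distinct cells look like pure noise unrelated to x. The obstacle is that the alternative
    consists of individual laws, not of mixtures, and that the gSNR must be large for the very law
    that fools the test. The link is therefore sought among levels pairwise more than 2r apart,
    where r bounds e with probability at least 3/4; the averaging argument still finds a link there
    because such levels have probability close to one. Everything happens at a fixed n: the cells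
    depend on n, and s depends on the number of cells. The bound on the gSNR depends on neither, so
    at each n the two errors of any test add up to at least 1/2 once [lam n] is below a fixed
    constant and p, s are positive. The covariance is a multiple of the identity and beta the first
    basis vector. The other coordinates of x are then independent of y, and the gSNR reduces to the
    second moment of one conditional expectation. *)

Section density.
Local Open Scope ereal_scope.
Context d (T : measurableType d) (R : realType).
Variables (mu nu : {measure set T -> \bar R}) (h : T -> R).
Hypotheses (mh : measurable_fun [set: T] h) (h0 : forall x, (0 <= h x)%R).
Hypothesis nuE : forall A, measurable A -> nu A = \int[mu]_(x in A) (h x)%:E.

Import HBNNSimple.

(** For indicators this is [nuE]; linearity gives simple functions, and monotone convergence along
    [nnsfun_approx] gives the rest. *)
Lemma ge0_integral_density (f : T -> \bar R) :
  measurable_fun [set: T] f -> (forall x, 0 <= f x) ->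
  \int[nu]_x f x = \int[mu]_x (f x * (h x)%:E).
Proof.
move=> mf f0; pose f_ := nnsfun_approx measurableT mf.
have f_E x : EFin \o f_ ^~ x @ \oo --> f x by exact: cvg_nnsfun_approx.
have nd_f x m n : (m <= n)%N -> ((f_ m x)%:E <= (f_ n x)%:E).
  by move=> mn; rewrite lee_fin; exact/lefP/nd_nnsfun_approx.
have mEh : measurable_fun [set: T] (EFin \o h) by exact/measurable_EFinP.
have mf_ n : measurable_fun [set: T] (EFin \o f_ n).
  exact/measurable_EFinP/measurable_funTS.
transitivity (limn (fun n => \int[nu]_x (f_ n x)%:E)).
  rewrite -monotone_convergence//=.
  - by apply: eq_integral => x _; exact/esym/cvg_lim/f_E.
  - by move=> n x _; rewrite lee_fin.
  - by move=> x _ m n; exact: nd_f.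
transitivity (limn (fun n => \int[mu]_x ((f_ n x)%:E * (h x)%:E))); last first.
  rewrite -monotone_convergence//=.
  - by apply: eq_integral => x _; apply/cvg_lim => //; exact/cvgeZr/f_E.
  - by move=> n; exact: emeasurable_funM (mf_ n) mEh.
  - by move=> n x _; rewrite mule_ge0// lee_fin.
  - by move=> x _ m n mn; apply: lee_wpmul2r; [rewrite lee_fin|exact: nd_f].
congr (limn _); apply/funext => n.
under eq_integral do rewrite fimfunE -fsumEFin//.
under [RHS]eq_integral.
  move=> x _; rewrite fimfunE -fsumEFin// ge0_mule_fsuml; last first.
    by move=> y; rewrite nnfun_muleindic_ge0.
  over.
rewrite ge0_integral_fsum//; last 2 first.
  - by move=> y; exact/measurable_EFinP/measurable_funM.
  - by move=> y x _; rewrite nnfun_muleindic_ge0.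
rewrite ge0_integral_fsum//; last 2 first.
  - move=> y; apply: emeasurable_funM => //.
    exact/measurable_EFinP/measurable_funM.
  - move=> y x _; rewrite mule_ge0 ?lee_fin//.
    by rewrite -lee_fin EFinM nnfun_muleindic_ge0.
apply: eq_fsbigr => r _; rewrite integralZl_indic_nnsfun// integral_indic//=.
(* The sum runs over all real values; a negative value of a nonnegative function has an empty
   preimage, so both sides vanish. *)
have [r0|r0] := leP 0%R r; last first.
  rewrite preimage_nnfun0// setIT measure0 mule0 integral0_eq// => x _.
  by rewrite indic0 mulr0 mul0e.
under eq_integral do rewrite EFinM -muleA.
rewrite ge0_integralZl//; last 2 first.
  - by apply: emeasurable_funM => //; exact/measurable_EFinP.
  - by move=> x _; rewrite mule_ge0 ?lee_fin.
rewrite setIT nuE// integral_mkcond; congr (_ * _); apply: eq_integral => x _.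
by rewrite patchE indicE; case: ifPn; rewrite ?mul1e ?mul0e.
Qed.

End density.

Section iid_integral.
Local Open Scope ereal_scope.
Context d (T : measurableType d) (R : realType).
Implicit Types P : probability T R.

Lemma ge0_integral_iid0 P (f : 0.-tuple T -> \bar R) :
  measurable_fun [set: 0.-tuple T] f -> \int[iid P 0]_w f w = f [tuple].
Proof. by move=> mf; rewrite /= integral_dirac// diracT mul1e. Qed.

Lemma ge0_integral_iidS P n (f : n.+1.-tuple T -> \bar R) :
  measurable_fun [set: n.+1.-tuple T] f -> (forall w, 0 <= f w) ->
  \int[iid P n.+1]_w f w =
  \int[P]_x \int[iid P n]_w f (cons_pair (x, w)).
Proof.
move=> mf f0; rewrite [LHS]ge0_integral_distribution//.
by rewrite fubini_tonelli1//=; exact: measurableT_comp.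
Qed.

Lemma tnth_cons0 n x (w : n.-tuple T) : tnth (cons_pair (x, w)) ord0 = x.
Proof. by []. Qed.

Lemma tnth_consS n x (w : n.-tuple T) i :
  tnth (cons_pair (x, w)) (lift ord0 i) = tnth w i.
Proof. by rewrite tnthS. Qed.

Lemma measurable_prod_tnth n (F : 'I_n -> T -> R) :
  (forall i, measurable_fun [set: T] (F i)) ->
  measurable_fun [set: n.-tuple T] (fun w => (\prod_(i < n) F i (tnth w i))%R).
Proof.
move=> mF; apply: measurable_prod => i _.
by apply: measurableT_comp => //; exact: measurable_tnth.
Qed.

(** Independence in product form. The factors may depend on the index, which serves both for levels
    of different cells and for single coordinates of a normal vector. *)
Lemma ge0_integral_iid_prod P n (F : 'I_n -> T -> R) :
  (forall i, measurable_fun [set: T] (F i)) -> (forall i x, (0 <= F i x)%R) ->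
  \int[iid P n]_w (\prod_(i < n) F i (tnth w i))%:E =
  \prod_(i < n) \int[P]_x (F i x)%:E.
Proof.
elim: n F => [|n IH] F mF F0.
  rewrite ge0_integral_iid0 ?big_ord0//.
  by apply/measurable_EFinP; exact: measurable_prod_tnth.
rewrite ge0_integral_iidS; last 2 first.
- by apply/measurable_EFinP; exact: measurable_prod_tnth.
- by move=> w; rewrite lee_fin prodr_ge0.
rewrite big_ord_recl -IH// muleC -ge0_integralZl//; last 3 first.
- exact/measurable_EFinP.
- by move=> x _; rewrite lee_fin.
- by apply: integral_ge0 => w _; rewrite lee_fin prodr_ge0.
apply: eq_integral => x _.
rewrite muleC -ge0_integralZl//; last 3 first.
- by apply/measurable_EFinP; exact: (@measurable_prod_tnth _ (fun i => F (lift ord0 i))).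
- by move=> w _; rewrite lee_fin prodr_ge0.
- by rewrite lee_fin.
apply: eq_integral => w _; rewrite big_ord_recl tnth_cons0 EFinM.
by congr (_ * (_)%:E); apply: eq_bigr => i _; rewrite tnth_consS.
Qed.

(** The likelihood ratio of a sample is the product of those of its points; each induction step
    changes the law of the first point and leaves the others to the induction hypothesis. *)
Lemma ge0_integral_iid_density (P Q : probability T R) (L : T -> R) n
    (f : n.-tuple T -> \bar R) :
  measurable_fun [set: T] L -> (forall x, (0 <= L x)%R) ->
  (forall g : T -> \bar R, measurable_fun [set: T] g -> (forall x, 0 <= g x) ->
    \int[Q]_x g x = \int[P]_x (g x * (L x)%:E)) ->
  measurable_fun [set: n.-tuple T] f -> (forall w, 0 <= f w) ->
  \int[iid Q n]_w f w =
  \int[iid P n]_w (f w * (\prod_(i < n) L (tnth w i))%:E).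
Proof.
move=> mL L0 QP; elim: n f => [|n IH] f mf f0.
  rewrite !ge0_integral_iid0//; first by rewrite big_ord0 mule1.
  apply: (emeasurable_funM mf); apply/measurable_EFinP.
  exact: (@measurable_prod_tnth _ (fun=> L)).
have mL' m : measurable_fun [set: m.-tuple T]
    (fun w => (\prod_(i < m) L (tnth w i))%:E).
  by apply/measurable_EFinP; exact: (@measurable_prod_tnth _ (fun=> L)).
have mfc : measurable_fun [set: T * n.-tuple T] (f \o @cons_pair _ T n).
  exact: measurableT_comp.
rewrite !ge0_integral_iidS//; last 2 first.
- exact: emeasurable_funM mf (mL' _).
- by move=> w; rewrite mule_ge0// lee_fin prodr_ge0.
rewrite QP; last 2 first.
- apply: (measurable_fun_fubini_tonelli_F (f \o @cons_pair _ T n)) => // u.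
  exact: f0.
- by move=> x; exact: integral_ge0.
apply: eq_integral => x _.
have mfx : measurable_fun [set: n.-tuple T] (fun w => f (cons_pair (x, w))).
  by apply: (measurableT_comp mfc); exact: measurable_pair1.
rewrite IH// -ge0_integralZr//; last 3 first.
- exact: emeasurable_funM mfx (mL' _).
- by move=> w _; rewrite mule_ge0// lee_fin prodr_ge0.
- by rewrite lee_fin.
apply: eq_integral => w _; rewrite big_ord_recl tnth_cons0 EFinM muleAC muleA.
congr (_ * _ * (_)%:E); apply: eq_bigr => i _; by rewrite tnth_consS.
Qed.

End iid_integral.

(** * Collisions in an i.i.d. sample *)

Section collisions.
Local Open Scope ereal_scope.
Context d (T : measurableType d) (R : realType) (P : probability T R).
Variables (e : T -> T -> bool) (delta : R).

(** The relation [e] need not be transitive: it is instantiated both with lying in the same cell,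
    for samples, and with lying within distance 2r, for levels. *)
Definition collision_free n : set (n.-tuple T) :=
  [set w | forall i j : 'I_n, i != j -> ~~ e (tnth w i) (tnth w j)].
Arguments collision_free : clear implicits.

Hypothesis me : measurable_fun [set: T * T] (fun u => e u.1 u.2).
Hypothesis e_sym : forall x y, e x y = e y x.
Hypothesis delta0 : (0 <= delta)%R.
Hypothesis Pe : forall y, P [set x | e x y] <= delta%:E.

Lemma measurable_collision_free n : measurable (collision_free n).
Proof.
rewrite (_ : collision_free n = \bigcap_(ij in [set ij : 'I_n * 'I_n | ij.1 != ij.2])
    ((fun w => e (tnth w ij.1) (tnth w ij.2)) @^-1` [set false])).
  apply: fin_bigcap_measurable => // -[i j] _.
  rewrite -[X in measurable X]setTI.
  suff : measurable_fun [set: n.-tuple T] (fun w => e (tnth w i) (tnth w j)).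
    by apply.
  apply: (measurableT_comp me (measurable_fun_pair _ _)) => //.
  - exact: measurable_tnth.
  - exact: measurable_tnth.
apply/seteqP; split => w /= H.
  by move=> [i j] /= ij; apply/negbTE/H.
by move=> i j ij; apply/negbT; exact: (H (i, j)).
Qed.

Lemma measurable_section y : measurable [set x | e x y].
Proof.
rewrite -[X in measurable X]setTI.
have : measurable_fun [set: T] (fun x => e x y).
  exact: (measurableT_comp me (measurable_fun_pair _ _)).
by move=> /(_ measurableT [set true]); apply.
Qed.

(** Given n earlier points, a new one collides with one of them with probability at most n delta, by
    the union bound; then n^2 + n is at most (n + 1)^2. *)
Lemma collision_le n : iid P n (~` collision_free n) <= (n%:R ^+ 2 * delta)%:E.
Proof.
elim: n => [|n IH].
  rewrite (_ : ~` _ = set0) ?measure0 ?lee_fin ?mulr_ge0 ?sqr_ge0//.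
  by rewrite -setCT; congr (~` _); apply/seteqP; split => // w _ [].
set B := ~` _ in IH; have mB : measurable B.
  by apply: measurableC; exact: measurable_collision_free.
set B1 := ~` _; have mB1 : measurable B1.
  by apply: measurableC; exact: measurable_collision_free.
have mI : measurable_fun [set: n.+1.-tuple T] (fun w => (\1_B1 w : R)%:E).
  by apply/measurable_EFinP.
pose g (u : T * n.-tuple T) := (\1_B1 (cons_pair u) : R)%:E.
have mg : measurable_fun [set: T * n.-tuple T] g by exact: (measurableT_comp mI).
have -> : iid P n.+1 B1 = \int[iid P n.+1]_w (\1_B1 w)%:E.
  by rewrite integral_indic// setIT.
rewrite ge0_integral_iidS// (fubini_tonelli g)//; last by move=> u; rewrite lee_fin.
have mB' : measurable_fun [set: n.-tuple T] (fun w => (\1_B w : R)%:E).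
  by apply/measurable_EFinP.
apply: (@le_trans _ _ (\int[iid P n]_w ((\1_B w)%:E + (n%:R * delta)%:E))).
  apply: ge0_le_integral => //.
  - by move=> w _; apply: integral_ge0 => x _; rewrite lee_fin.
  - by apply: (measurable_fun_fubini_tonelli_G g) => // u; rewrite lee_fin.
  - by apply: (emeasurable_funD mB'); exact: measurable_cst.
  - move=> w _; have mBw : measurable ((fun x => cons_pair (x, w)) @^-1` B1).
      rewrite -[X in measurable X]setTI.
      suff : measurable_fun [set: T] (fun x => cons_pair (x, w)) by apply.
      by apply: measurableT_comp => //; exact: measurable_pair2.
    rewrite [leLHS](_ : _ = P ((fun x => cons_pair (x, w)) @^-1` B1)); last first.
      by have := integral_indic P measurableT mBw; rewrite setIT => <-.
    have [wB|wB] := pselect (B w).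
      rewrite indicE mem_set//= (le_trans (probability_le1 P mBw))//.
      by rewrite leeDl// lee_fin mulr_ge0.
    rewrite indicE memNset//= add0e.
    have [->|/set0P[x0 _]] := eqVneq ((fun x => cons_pair (x, w)) @^-1` B1) set0.
      by rewrite measure0 lee_fin mulr_ge0.
    (* The events are indexed by all naturals to fit subadditivity; [x0], a point of the nonempty
       bad set, is only the default of [nth]. *)
    pose A k := [set x | e x (nth x0 w k)].
    have mA k : measurable (A k) by exact: measurable_section.
    apply: (@le_trans _ _ (\sum_(k < n) P (A k))).
      apply: (@content_subadditive _ _ _ P) => //.
      move=> x /= Bx; rewrite -bigcup_mkord /=; apply: contrapT => Ax; apply: Bx.
      have nAx i : ~~ e x (tnth w i).
        apply/negP => exi; apply: Ax; exists (nat_of_ord i) => /=.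
          exact: ltn_ord.
        by rewrite /A /= -tnth_nth.
      move=> i j.
      case: (unliftP (@ord0 n) i) => [i'|] ->; case: (unliftP (@ord0 n) j) => [j'|] ->.
      + rewrite (inj_eq (@lift_inj _ _)) !tnth_consS.
        by move=> ij; move/contrapT: wB; apply.
      + by rewrite tnth_consS (tnth_cons0 x w) e_sym => _; exact: nAx.
      + by rewrite tnth_consS (tnth_cons0 x w) => _; exact: nAx.
      + by rewrite eqxx.
    apply: (@le_trans _ _ (\sum_(k < n) delta%:E)).
      by apply: lee_sum => k _; exact: Pe.
    by rewrite sumEFin sumr_const card_ord mulr_natl.
rewrite ge0_integralD//; last by move=> x _; rewrite lee_fin mulr_ge0.
rewrite integral_indic// setIT integral_cst// [X in _ * X]probability_setT mule1.
apply: (le_trans (leeD2r _ IH)).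
rewrite -EFinD lee_fin -mulrDl ler_wpM2r//.
by rewrite -natr1; have := ler0n R n; nra.
Qed.

End collisions.
Arguments collision_free {d T} e n.

(** * Normal laws *)

Section normal.
Context (R : realType).
Implicit Types (m s a b r x y : R).
Local Notation leb := (@lebesgue_measure R).

Lemma ge0_integral_normal m s (f : R -> \bar R) :
  measurable_fun [set: R] f -> (forall x, (0 <= f x)%E) ->
  (\int[normal_prob m s]_x f x = \int[leb]_x (f x * (normal_pdf m s x)%:E))%E.
Proof.
apply: (@ge0_integral_density _ _ R leb (normal_prob m s)) => //.
- exact: measurable_normal_pdf.
- exact: normal_pdf_ge0.
Qed.

(** Lebesgue measure is characterised by its values on half-open intervals, and a shift preserves
    lengths. *)
Lemma lebesgue_measure_shift a (A : set R) : measurable A ->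
  pushforward leb ((fun x => a + x) : measurableTypeR R -> measurableTypeR R) A = leb A.
Proof.
move=> mA; have mphi : measurable_fun [set: measurableTypeR R]
    ((fun x => a + x) : measurableTypeR R -> measurableTypeR R).
  exact: measurable_funD.
apply/esym/lebesgue_measure_unique => //= _ [[u v]] _ <-; rewrite /pushforward.
rewrite (_ : _ @^-1` _ = `]u - a, v - a]%classic); last first.
  by apply/seteqP; split => x /=; rewrite !in_itv/=; lra.
by rewrite !lebesgue_measure_itv/= !lte_fin ltrD2r !EFinN -!EFinD; case: ifP => // _; congr EFin; ring.
Qed.

Lemma ge0_integral_shift a (f : R -> \bar R) :
  measurable_fun [set: R] f -> (forall x, (0 <= f x)%E) ->
  (\int[leb]_x f (a + x)%R = \int[leb]_x f x)%E.
Proof.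
move=> mf f0; pose phi := (fun x => a + x) : measurableTypeR R -> measurableTypeR R.
have mphi : measurable_fun [set: measurableTypeR R] phi by exact: measurable_funD.
transitivity (\int[pushforward leb phi]_x f x)%E.
  by rewrite ge0_integral_pushforward.
by apply: eq_measure_integral => A mA _; exact: lebesgue_measure_shift.
Qed.

Lemma ge0_integral_opp (f : R -> \bar R) :
  measurable_fun [set: R] f -> (forall x, (0 <= f x)%E) ->
  (\int[leb]_x f (- x)%R = \int[leb]_x f x)%E.
Proof.
move=> mf f0; pose phi := (fun x => - x) : measurableTypeR R -> measurableTypeR R.
have mphi : measurable_fun [set: measurableTypeR R] phi by exact: oppr_measurable.
transitivity (\int[pushforward leb phi]_x f x)%E.
  by rewrite ge0_integral_pushforward.
by apply: eq_measure_integral => A mA _; exact: lebesgue_measureN.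
Qed.

Lemma normal_pdf_gt0 m s x : s != 0 -> 0 < normal_pdf m s x.
Proof. by move=> s0; rewrite normal_pdfE// mulr_gt0 ?normal_peak_gt0 ?expR_gt0. Qed.

Lemma normal_pdf_shift a s x : s != 0 ->
  normal_pdf a s (a + x) = normal_pdf 0 s x.
Proof. by move=> s0; rewrite !normal_pdfE// /normal_fun subr0 addrC addKr. Qed.

Lemma ge0_integral_normal_shift a s (f : R -> \bar R) : s != 0 ->
  measurable_fun [set: R] f -> (forall x, (0 <= f x)%E) ->
  (\int[normal_prob 0%R s]_x f (a + x)%R =
   \int[leb]_x (f x * (normal_pdf a s x)%:E))%E.
Proof.
move=> s0 mf f0.
pose F x := (f x * (normal_pdf a s x)%:E)%E.
have mF : measurable_fun [set: R] F.
  apply: (emeasurable_funM mf); apply/measurable_EFinP.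
  exact: measurable_normal_pdf.
have mfa : measurable_fun [set: R] (fun x => f (a + x)).
  by apply: (measurableT_comp mf); exact: measurable_funD.
have F0 x : (0 <= F x)%E by rewrite /F mule_ge0// lee_fin normal_pdf_ge0.
rewrite (ge0_integral_normal 0 s mfa); last by move=> x; exact: f0.
rewrite -[RHS](ge0_integral_shift a mF F0).
by apply: eq_integral => x _; rewrite /F normal_pdf_shift.
Qed.

Lemma ge0_integral_normal_opp s (f : R -> \bar R) : s != 0 ->
  measurable_fun [set: R] f -> (forall x, (0 <= f x)%E) ->
  (\int[normal_prob 0%R s]_x f (- x)%R = \int[normal_prob 0%R s]_x f x)%E.
Proof.
move=> s0 mf f0.
pose F x := (f x * (normal_pdf 0 s x)%:E)%E.
have mF : measurable_fun [set: R] F.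
  apply: (emeasurable_funM mf); apply/measurable_EFinP.
  exact: measurable_normal_pdf.
have mfN : measurable_fun [set: R] (fun x => f (- x)).
  by apply: (measurableT_comp mf); exact: oppr_measurable.
have F0 x : (0 <= F x)%E by rewrite /F mule_ge0// lee_fin normal_pdf_ge0.
rewrite (ge0_integral_normal 0 s mfN); last by move=> x; exact: f0.
rewrite (ge0_integral_normal 0 s mf f0).
rewrite -[RHS](ge0_integral_opp mF F0).
by apply: eq_integral => x _; rewrite /F !normal_pdfE// /normal_fun !subr0 sqrrN.
Qed.

(** Completion of the square in [a]. With [S] the prior variance, the posterior has mean
    [S / (1 + S) * y] and variance [S / (1 + S)]. *)
Lemma conj_exponent (S a y : R) : 0 < S ->
  - (y - a) ^+ 2 / (1 ^+ 2 *+ 2) + - a ^+ 2 / (S *+ 2) =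
  - y ^+ 2 / ((1 + S) *+ 2) +
  - (a - S / (1 + S) * y) ^+ 2 / (S / (1 + S) *+ 2).
Proof.
move=> S0; have S_neq0 : S != 0 by rewrite gt_eqF.
have S1_neq0 : 1 + S != 0 by rewrite gt_eqF// addr_gt0.
by field; rewrite S_neq0 S1_neq0.
Qed.

(* Bayes' rule for a normal mean with a normal prior. *)
Lemma normal_pdf_conj s a y : 0 < s ->
  normal_pdf a 1 y * normal_pdf 0 s a =
  normal_pdf 0 (Num.sqrt (1 + s ^+ 2)) y *
  normal_pdf (s ^+ 2 / (1 + s ^+ 2) * y) (s / Num.sqrt (1 + s ^+ 2)) a.
Proof.
move=> s0; set t := Num.sqrt _.
have t2 : t ^+ 2 = 1 + s ^+ 2 by rewrite sqr_sqrtr// addr_ge0// sqr_ge0.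
have t0 : 0 < t by rewrite sqrtr_gt0 ltr_wpDr ?sqr_ge0.
have s_neq0 : s != 0 by rewrite gt_eqF.
have t_neq0 : t != 0 by rewrite gt_eqF.
have st0 : s / t != 0 by rewrite mulf_neq0// invr_eq0.
have st2 : (s / t) ^+ 2 = s ^+ 2 / (1 + s ^+ 2) by rewrite expr_div_n t2.
rewrite !normal_pdfE ?oner_eq0// /normal_fun mulrACA [RHS]mulrACA; congr (_ * _).
  rewrite /normal_peak -!invfM -!sqrtrM; last 2 first.
  - by rewrite mulrn_wge0// mulr_ge0 ?sqr_ge0// pi_ge0.
  - by rewrite mulrn_wge0// mulr_ge0 ?sqr_ge0// pi_ge0.
  rewrite st2 t2; congr (Num.sqrt _)^-1.
  by field; rewrite -t2 expf_neq0.
by rewrite -!expRD subr0 st2 t2 subr0 conj_exponent// exprn_gt0.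
Qed.

(** The density is at most its peak and the interval has length 2r. The bound is uniform in the
    centre [b], as collision bounds require. *)
Lemma normal_interval_le m s b r : s != 0 -> 0 <= r ->
  (normal_prob m s [set x : R | (`|x - b| <= r)%R] <= (r *+ 2 * normal_peak s)%:E)%E.
Proof.
move=> s0 r0.
have -> : [set x : R | (`|x - b| <= r)%R] = `[b - r, b + r]%classic.
  by apply/seteqP; split => x /=; rewrite in_itv/= ler_distl.
set A := [set` _]; rewrite /normal_prob.
apply: (@le_trans _ _ (\int[leb]_(x in A) (normal_peak s)%:E)%E).
  apply: ge0_le_integral => //.
  - exact: measurable_itv.
  - by move=> x _; rewrite lee_fin normal_pdf_ge0.
  - apply/measurable_EFinP/measurable_funTS; exact: measurable_normal_pdf.
  - by move=> x _; rewrite lee_fin normal_pdf_ub.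
rewrite integral_cst/= ?/A ?lebesgue_measure_itv/=; last exact: measurable_itv.
case: ifP => _; last by rewrite mule0 lee_fin mulr_ge0 ?mulrn_wge0// normal_peak_ge0.
rewrite -EFinB -EFinM lee_fin mulrC ler_wpM2r ?normal_peak_ge0//.
by rewrite -mulr_natr; lra.
Qed.

(** A widely spread normal law is flat: the peak 1 / sqrt (2 pi s^2) is at most 1 / s, hence the
    witness. *)
Lemma normal_peak_small (e : R) : 0 < e -> exists2 s, 0 < s & normal_peak s <= e.
Proof.
move=> e0; exists e^-1; rewrite ?invr_gt0//.
rewrite /normal_peak -[leRHS]invrK lef_pV2 ?posrE ?invr_gt0// ?sqrtr_gt0; last first.
  by rewrite mulrn_wgt0// mulr_gt0 ?pi_gt0// exprn_gt0// invr_gt0.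
apply: (@le_trans _ _ (Num.sqrt (e^-1 ^+ 2))).
  by rewrite sqrtr_sqr ger0_norm// invr_ge0 ltW.
rewrite ler_wsqrtr// -mulrnAr ler_peMr ?sqr_ge0//.
by have := pi_ge2 R; lra.
Qed.

Lemma normal_abs_lty : (\int[normal_prob 0%R 1%R]_x `|x|%:E < +oo :> \bar R)%E.
Proof.
rewrite ge0_integral_normal//; last by apply/measurable_EFinP; exact: normr_measurable.
(* The factor |x| is absorbed by doubling the standard deviation: |x| <= 4 (1 + 3 x^2 / 8) <= 4 exp
   (3 x^2 / 8), where 3/8 = 1/2 - 1/8 is the gap between the two exponents. *)
pose C : R := 4 * normal_peak 1 / normal_peak 2.
apply: (@le_lt_trans _ _ (\int[leb]_x (C * normal_pdf 0 2 x)%:E)%E); last first.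
  under eq_integral do rewrite EFinM.
  rewrite integralZl//; last exact: integrable_normal_pdf.
  by rewrite integral_normal_pdf mule1 ltry.
apply: ge0_le_integral => //.
- by move=> x _; rewrite mule_ge0// lee_fin normal_pdf_ge0.
- apply: emeasurable_funM; first by apply/measurable_EFinP; exact: normr_measurable.
  by apply/measurable_EFinP; exact: measurable_normal_pdf.
- apply/measurable_EFinP; apply: measurable_funM => //; exact: measurable_normal_pdf.
move=> x _; rewrite -EFinM lee_fin !normal_pdfE// ?oner_eq0//.
have p2 : 0 < normal_peak (2 : R) by rewrite normal_peak_gt0.
have -> : C * (normal_peak 2 * normal_fun 0 2 x) =
    normal_peak 1 * (4 * normal_fun 0 2 x).
  by rewrite /C; field; rewrite gt_eqF.
rewrite mulrCA ler_wpM2l ?normal_peak_ge0//.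
rewrite /normal_fun !subr0.
have -> : - x ^+ 2 / (1 ^+ 2 *+ 2) = - x ^+ 2 / (2 ^+ 2 *+ 2) - 3 / 8 * x ^+ 2 :> R.
  by field.
rewrite expRD mulrCA [4 * _]mulrC ler_wpM2l ?expR_ge0//.
rewrite -ler_pdivlMr ?expR_gt0// expRN invrK.
apply: (@le_trans _ _ (4 * (1 + 3 / 8 * x ^+ 2))); last first.
  by rewrite ler_wpM2l// expR_ge1Dx.
by rewrite -(real_normK (num_real x)); have := sqr_ge0 (`|x| - 1); nra.
Qed.

(** On [1, 2] the integrand is at least the density at 2. *)
Lemma normal_pos_gt0 :
  (0 < \int[normal_prob 0%R 1%R]_x (Num.max x 0)%:E :> \bar R)%E.
Proof.
rewrite ge0_integral_normal//; last 2 first.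
- by apply/measurable_EFinP; exact: measurable_maxr.
- by move=> x; rewrite lee_fin le_max lexx orbT.
apply: (@lt_le_trans _ _ (\int[leb]_(x in `[1%R, 2%R]) (normal_pdf 0 1 2)%:E)%E).
  have leb12 : leb `[1, 2]%classic = 1%:E.
    by rewrite lebesgue_measure_itv/= lte_fin ltr1n -EFinB; congr EFin; ring.
  rewrite integral_cst//= [X in (_ * X)%E](_ : _ = 1%:E)// mule1 lte_fin.
  by rewrite normal_pdf_gt0 ?oner_eq0.
apply: (@le_trans _ _ (\int[leb]_(x in `[1%R, 2%R]) ((Num.max x 0)%:E * (normal_pdf 0 1 x)%:E))%E).
  apply: ge0_le_integral => //.
  - by move=> x _; rewrite lee_fin normal_pdf_ge0.
  - apply: measurable_funTS; apply: emeasurable_funM.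
      by apply/measurable_EFinP; exact: measurable_maxr.
    by apply/measurable_EFinP; exact: measurable_normal_pdf.
  move=> x /=; rewrite in_itv/= => /andP[x1 x2].
  rewrite -EFinM lee_fin max_l ?(le_trans _ x1)//.
  apply: (@le_trans _ _ (1 * normal_pdf 0 1 x)); last by rewrite ler_wpM2r ?normal_pdf_ge0.
  rewrite mul1r !normal_pdfE ?oner_eq0// ler_wpM2l ?normal_peak_ge0// ler_expR.
  by rewrite !subr0 ler_pM2r ?invr_gt0// lerN2 ler_sqr ?nnegrE// ?(le_trans _ x1).
apply: ge0_subset_integral => //.
- apply: emeasurable_funM; first by apply/measurable_EFinP; exact: measurable_maxr.
  by apply/measurable_EFinP; exact: measurable_normal_pdf.
- by move=> x _; rewrite -EFinM lee_fin mulr_ge0 ?normal_pdf_ge0// le_max lexx orbT.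
Qed.

Lemma normal_tail_small (e : R) : 0 < e ->
  exists2 k, 0 < k & (normal_prob 0%R 1%R [set x : R | (k <= `|x|)%R] <= e%:E :> \bar R)%E.
Proof.
move=> e0; pose C := fine (\int[normal_prob 0%R (1:R)]_x `|x|%:E)%E.
have C0 : 0 <= C by apply/fine_ge0/integral_ge0.
have CE : (\int[normal_prob 0%R (1:R)]_x `|x|%:E = C%:E)%E.
  by rewrite fineK// ge0_fin_numE ?normal_abs_lty// integral_ge0.
(* Markov's inequality with mean [C]; the added 1 makes [k] positive without knowing that [C] is. *)
pose k := C / e + 1; have k0 : 0 < k by rewrite ltr_wpDl ?divr_ge0// ltW.
exists k => //.
have mabs : measurable_fun [set: R] (fun x => `|x|%:E : \bar R).
  by apply/measurable_EFinP; exact: normr_measurable.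
have := @le_integral_abse _ _ R (normal_prob 0%R 1%R) setT measurableT (fun x => `|x|%:E) k mabs k0.
rewrite setTI.
have -> : [set x : R | (k%:E <= abse (`|x|%:E))%E] = [set x : R | (k <= `|x|)%R].
  by apply/seteqP; split => x /=; rewrite lee_fin normr_id.
under eq_integral do rewrite /= normr_id.
rewrite CE => kP.
rewrite -(@lee_pmul2l _ k%:E)// (le_trans kP)// -EFinM lee_fin /k.
by rewrite mulrDl mul1r divfK ?gt_eqF// lerDl ltW.
Qed.

End normal.

(** * Random links *)

Section likelihood.
Context (R : realType).
Implicit Types (s a y : R).
Local Notation leb := (@lebesgue_measure R).

(** The standard deviation of a response once its level, of variance s^2, is averaged out. *)
Definition tau s := Num.sqrt (1 + s ^+ 2).

Lemma tau_neq0 s : tau s != 0.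
Proof. by rewrite gt_eqF// sqrtr_gt0 ltr_wpDr ?sqr_ge0. Qed.

(** The likelihood ratio at [y] of a response with level [a] against the null response. *)
Definition lik s y a := normal_pdf a 1 y / normal_pdf 0 (tau s) y.

Lemma lik_ge0 s y a : 0 <= lik s y a.
Proof. by rewrite divr_ge0 ?normal_pdf_ge0. Qed.

Lemma likK s y a : lik s y a * normal_pdf 0 (tau s) y = normal_pdf a 1 y.
Proof. by rewrite divfK// gt_eqF// normal_pdf_gt0// tau_neq0. Qed.

(** The quotient of the two densities is a constant times the exponential of a quadratic polynomial,
    which is visibly measurable. *)
Lemma measurable_lik s d (T : measurableType d) (f g : T -> R) :
  measurable_fun [set: T] f -> measurable_fun [set: T] g ->
  measurable_fun [set: T] (fun t => lik s (f t) (g t)).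
Proof.
move=> mf mg; pose pk := normal_peak (1 : R); pose pt := normal_peak (tau s).
have -> : (fun t => lik s (f t) (g t)) = (fun t => pk / pt *
    expR (f t ^+ 2 / (tau s ^+ 2 *+ 2) - (f t - g t) ^+ 2 / 2)).
  apply/funext => t; rewrite /lik !normal_pdfE ?oner_eq0 ?tau_neq0//.
  rewrite /normal_fun invfM -expRN mulrACA -expRD subr0.
  by congr (_ * expR _); field; exact: tau_neq0.
apply: measurable_funM => //; apply: measurableT_comp => //.
by apply: measurable_funB; apply: measurable_funM => //; apply: measurable_funX => //;
  exact: measurable_funB.
Qed.

(** By Bayes' rule, the likelihood ratio times the prior density is the posterior density of the
    level, which has mass one. This is why a single response per cell carries no information. *)
Lemma integral_lik s y : 0 < s ->
  (\int[normal_prob 0%R s]_a (lik s y a)%:E = 1)%E.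
Proof.
move=> s0; rewrite ge0_integral_normal; last 2 first.
- by apply/measurable_EFinP; exact: measurable_lik.
- by move=> a; rewrite lee_fin lik_ge0.
rewrite -(integral_normal_pdf (s ^+ 2 / (1 + s ^+ 2) * y) (s / tau s)).
apply: eq_integral => a _; rewrite -EFinM /lik mulrAC normal_pdf_conj//.
by rewrite mulrAC mulfV ?mul1r// gt_eqF// normal_pdf_gt0// tau_neq0.
Qed.

End likelihood.

(** * Responses with additive normal noise *)

Section noisy.
Context (R : realType) d (X : measurableType d) (mu : probability X R).

Definition noise_map (h : X -> R) (xe : X * measurableTypeR R) : R * X := (h xe.1 + xe.2, xe.1).

Lemma measurable_noise_map (h : {mfun X >-> R}) :
  measurable_fun [set: X * measurableTypeR R] (noise_map h).
Proof.
apply: measurable_fun_pair => //; apply: measurable_funD => //.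
exact: measurableT_comp.
Qed.

HB.instance Definition _ (h : {mfun X >-> R}) :=
  isMeasurableFun.Build _ _ _ _ (noise_map h) (measurable_noise_map h).

(** Both hypotheses have this form: a constant [h] gives null laws, a step function [h] gives
    alternatives. *)
Definition noisy (h : {mfun X >-> R}) (s : R) : probability (R * X)%type R :=
  distribution (mu \x normal_prob 0%R s)%E (noise_map h).

Lemma ge0_integral_noisy (h : {mfun X >-> R}) s (f : R * X -> \bar R) :
  measurable_fun [set: R * X] f -> (forall t, 0 <= f t)%E ->
  (\int[noisy h s]_t f t =
   \int[mu]_x \int[normal_prob 0%R s]_e f (h x + e, x)%R)%E.
Proof.
move=> mf f0; rewrite ge0_integral_distribution// fubini_tonelli1//.
  exact: measurableT_comp.
by move=> u; exact: f0.
Qed.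

Lemma measurable_fun_fst x (f : R * X -> \bar R) :
  measurable_fun [set: R * X] f -> measurable_fun [set: R] (fun y => f (y, x)).
Proof. by move=> mf; apply: (measurableT_comp mf); exact: measurable_pair2. Qed.

(** The marginal of x is the same on both sides, so the likelihood ratio is that of y given x. *)
Lemma noisy_density (h : {mfun X >-> R}) s (f : R * X -> \bar R) :
  measurable_fun [set: R * X] f -> (forall t, 0 <= f t)%E ->
  (\int[noisy h 1]_t f t =
   \int[noisy (cst 0%R) (tau s)]_t (f t * (lik s t.1 (h t.2))%:E))%E.
Proof.
move=> mf f0.
have mL : measurable_fun [set: R * X] (fun t => (lik s t.1 (h t.2))%:E).
  by apply/measurable_EFinP; apply: measurable_lik => //; exact: measurableT_comp.
have mfL := emeasurable_funM mf mL.
have fL0 t : (0 <= f t * (lik s t.1 (h t.2))%:E)%E.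
  by rewrite mule_ge0// lee_fin lik_ge0.
apply: (etrans (ge0_integral_noisy h 1 mf f0)); apply/esym.
apply: (etrans (ge0_integral_noisy (cst 0%R) (tau s) mfL fL0)); apply/esym.
apply: eq_integral => x _.
have mfx := measurable_fun_fst x mf.
apply: (etrans (ge0_integral_normal_shift (h x) (oner_neq0 R) mfx _)).
  by move=> y; exact: f0.
under [RHS]eq_integral do rewrite /= add0r.
apply/esym; apply: (etrans (ge0_integral_normal 0 (tau s) (measurable_fun_fst x mfL) _)).
  by move=> y; exact: fL0.
by apply: eq_integral => y _; rewrite -muleA -EFinM likK.
Qed.

End noisy.

(** * Averaging over the levels of a step link *)

Section random_link.
Context (R : realType) d (X : measurableType d) (mu : probability X R).
Variables (N : nat) (kappa : {mfun X >-> nat}) (s : R).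
Hypothesis kappaN : forall x, (kappa x < N)%N.
Hypothesis s0 : 0 < s.

Definition link (G : seq R) (x : X) : R := nth 0 G (kappa x).

Lemma link_tnth (G : N.-tuple R) x : link G x = tnth G (Ordinal (kappaN x)).
Proof. by rewrite (tnth_nth 0). Qed.

(** As a finite sum of levels times cell indicators, the link is measurable jointly in the levels
    and the point, which Tonelli's theorem needs below. *)
Lemma link_sum (G : N.-tuple R) x :
  link G x = \sum_(j < N) tnth G j * (kappa x == j)%:R.
Proof.
rewrite link_tnth (bigD1 (Ordinal (kappaN x)))//= eqxx mulr1 big1 ?addr0//.
move=> j /eqP jk; rewrite (_ : _ == _ = false) ?mulr0//.
by apply/eqP => kj; apply: jk; exact: val_inj.
Qed.

Lemma measurable_kappa_eq d' (T : measurableType d') (f : T -> X) j :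
  measurable_fun [set: T] f ->
  measurable_fun [set: T] (fun t => (kappa (f t) == j)%:R : R).
Proof.
move=> mf; have -> : (fun t => (kappa (f t) == j)%:R) =
    \1_((kappa \o f) @^-1` [set j]) :> (T -> R).
  apply/funext => t; rewrite indicE; congr (nat_of_bool _)%:R.
  by apply/eqP/idP; rewrite inE.
apply: measurable_indic; rewrite -[X in measurable X]setTI.
have : measurable_fun [set: T] (kappa \o f) by exact: measurableT_comp.
by apply.
Qed.

Lemma measurable_link d' (T : measurableType d') (g : T -> N.-tuple R) (f : T -> X) :
  measurable_fun [set: T] g -> measurable_fun [set: T] f ->
  measurable_fun [set: T] (fun t => link (g t) (f t)).
Proof.
move=> mg mf; under eq_fun do rewrite link_sum.
apply: measurable_sum => j; apply: measurable_funM.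
  exact: (measurableT_comp (measurable_tnth j) mg).
exact: measurable_kappa_eq.
Qed.

Lemma measurable_link1 (G : N.-tuple R) : measurable_fun [set: X] (link G).
Proof. by apply: (@measurable_link _ _ (fun=> G) id). Qed.

Definition mlink (G : N.-tuple R) : {mfun X >-> R} :=
  mfun_Sub (mem_set (measurable_link1 G)).

Local Notation Q0 := (noisy mu (cst 0) (tau s)).
Local Notation QG G := (noisy mu (mlink G) 1).
Local Notation gamma := (iid (normal_prob (0 : R) s) N).

Definition same_cell (t t' : R * X) := kappa t.2 == kappa t'.2.

Lemma measurable_same_cell :
  measurable_fun [set: (R * X) * (R * X)] (fun u => same_cell u.1 u.2).
Proof.
have mk (f : (R * X) * (R * X) -> R * X) : measurable_fun setT f ->
    measurable_fun [set: (R * X) * (R * X)] (fun u => kappa (f u).2).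
  move=> mf; apply: (measurableT_comp (measurable_funPT kappa)).
  exact: measurableT_comp.
by apply: measurable_fun_eqn; apply: mk.
Qed.

Section sample.
Variable n : nat.
Implicit Types (A : set (n.-tuple (R * X)%type)) (t : n.-tuple (R * X)%type).

Definition likn (G : seq R) t :=
  \prod_(i < n) lik s (tnth t i).1 (link G (tnth t i).2).

Lemma likn_ge0 G t : 0 <= likn G t.
Proof. by apply: prodr_ge0 => i _; exact: lik_ge0. Qed.

Lemma measurable_likn d' (T : measurableType d') (g : T -> N.-tuple R)
    (f : T -> n.-tuple (R * X)%type) :
  measurable_fun [set: T] g -> measurable_fun [set: T] f ->
  measurable_fun [set: T] (fun u => likn (g u) (f u)).
Proof.
move=> mg mf; apply: measurable_prod => i _.
have mfi : measurable_fun [set: T] (fun u => tnth (f u) i).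
  exact: (measurableT_comp (measurable_tnth i) mf).
apply: measurable_lik; first exact: measurableT_comp.
by apply: measurable_link => //; exact: measurableT_comp.
Qed.

(** Grouping the sample by cells turns the likelihood into a product over independent levels.
    Without collisions each cell holds at most one point: an occupied cell contributes 1 by
    [integral_lik], an empty one an empty product. *)
Lemma integral_likn t : collision_free same_cell n t ->
  (\int[gamma]_G (likn G t)%:E = 1)%E.
Proof.
move=> ct; pose o i := Ordinal (kappaN (tnth t i).2).
pose F (j : 'I_N) (a : R) := \prod_(i < n | o i == j) lik s (tnth t i).1 a.
have -> : (fun G : N.-tuple R => (likn G t)%:E) =
    (fun G : N.-tuple R => (\prod_(j < N) F j (tnth G j))%:E).
  apply/funext => G; congr EFin; rewrite /likn (partition_big o xpredT)//=.
  apply: eq_bigr => j _; apply: eq_bigr => i /eqP <-.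
  by rewrite link_tnth.
rewrite ge0_integral_iid_prod; last 2 first.
- move=> j; have -> : F j = fun a =>
      \prod_(i < n) (if o i == j then lik s (tnth t i).1 a else 1).
    by apply/funext => a; rewrite /F big_mkcond.
  apply: measurable_prod => i _; case: (o i == j) => //.
  exact: measurable_lik.
- by move=> j a; apply: prodr_ge0 => i _; exact: lik_ge0.
apply: big1 => j _; rewrite /F.
have [i0 /eqP oi0|oj] := pickP (fun i => o i == j).
  under eq_integral => a _.
    rewrite (big_pred1 i0) => [|i]; first over.
    apply/eqP/eqP => [oi|->//]; apply/eqP/negPn/negP => ii0.
    have /negP := ct _ _ ii0; apply; rewrite /same_cell.
    by have /(congr1 val)/= -> : o i = o i0 by rewrite oi oi0.
  exact: integral_lik.
under eq_integral => a _ do rewrite big_pred0//.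
by rewrite integral_cst// mul1e; exact: (@probability_setT _ _ _ (normal_prob 0 s)).
Qed.

Lemma iid_QG G A : measurable A ->
  iid (QG G) n A = (\int[iid Q0 n]_t ((\1_A t)%:E * (likn G t)%:E))%E.
Proof.
move=> mA.
have -> : iid (QG G) n A = (\int[iid (QG G) n]_t (\1_A t)%:E)%E.
  by rewrite integral_indic// setIT.
pose L (u : R * X) := lik s u.1 (link G u.2).
have mL : measurable_fun [set: R * X] L.
  by apply: measurable_lik => //; apply: (measurableT_comp (measurable_link1 G)).
have L0 u : 0 <= L u by exact: lik_ge0.
have mI : measurable_fun [set: n.-tuple (R * X)%type] (fun t => (\1_A t)%:E : \bar R).
  exact/measurable_EFinP.
have I0 t : (0 <= (\1_A t)%:E :> \bar R)%E by rewrite lee_fin.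
exact: (ge0_integral_iid_density mL L0 (fun g mg g0 => noisy_density mu (mlink G) s mg g0) mI I0).
Qed.

Let H A (u : N.-tuple (measurableTypeR R) * n.-tuple (R * X)%type) : \bar R :=
  ((\1_A u.2)%:E * (likn u.1 u.2)%:E)%E.

Let measurable_H A : measurable A -> measurable_fun [set: _] (H A).
Proof.
move=> mA; apply: emeasurable_funM; apply/measurable_EFinP.
  by apply: measurableT_comp.
exact: measurable_likn.
Qed.

Let H_ge0 A u : (0 <= H A u)%E.
Proof. by rewrite mule_ge0// lee_fin ?likn_ge0. Qed.

Lemma measurable_iid_QG A : measurable A ->
  measurable_fun [set: N.-tuple (measurableTypeR R)] (fun G => iid (QG G) n A).
Proof.
move=> mA; under eq_fun do rewrite iid_QG//.
exact: (measurable_fun_fubini_tonelli_F (H A) (measurable_H mA) (@H_ge0 A)).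
Qed.

(** After exchanging the integrals, the inner one is the averaged likelihood, which equals 1 at
    every collision-free sample. The identity is exact because [A] contains no other samples. *)
Lemma mixture_iid_QG A : measurable A -> A `<=` collision_free same_cell n ->
  (\int[gamma]_G iid (QG G) n A = iid Q0 n A)%E.
Proof.
move=> mA AD; under eq_integral do rewrite iid_QG//.
rewrite (fubini_tonelli (H A) (measurable_H mA) (@H_ge0 A)).
have -> : iid Q0 n A = (\int[iid Q0 n]_t (\1_A t)%:E)%E.
  by rewrite integral_indic// setIT.
apply: eq_integral => t _; rewrite /H/=.
rewrite ge0_integralZl//; last 2 first.
- by apply/measurable_EFinP; exact: measurable_likn.
- by move=> G _; rewrite lee_fin likn_ge0.
rewrite indicE; have [tA|] := boolP (t \in A); last by rewrite mul0e.
by rewrite integral_likn ?mul1e//; apply/AD; rewrite -inE.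
Qed.

(** Otherwise every G in S would give A less than Q0(A) - eta. The average over G of the mass of A
    without collisions would be at most Q0(A) - eta + gamma(~S), yet it equals the null mass of that
    set, at least Q0(A) minus the collision probability. This contradicts the bound on the two bad
    events. *)
Lemma exists_fooling_link (S : set (N.-tuple (measurableTypeR R))) (eta : R) A :
  measurable S -> measurable A -> eta <= 1 ->
  (iid Q0 n (~` collision_free same_cell n) + gamma (~` S) < eta%:E)%E ->
  exists2 G, S G & (iid Q0 n A <= iid (QG G) n A + eta%:E)%E.
Proof.
move=> mS mA eta1 bad; set D := collision_free _ _ in bad.
have mD : measurable D by exact: (measurable_collision_free (e := same_cell) measurable_same_cell).
have mAD : measurable (A `&` D) by exact: measurableI.
have fin (n' : nat) d' (T' : measurableType d') (P : probability T' R) (B : set T') :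
    measurable B -> exists2 r : R, P B = r%:E & 0 <= r.
  move=> mB; exists (fine (P B)); last exact: fine_ge0.
  by rewrite fineK// fin_num_measure.
have [a aE a0] := fin 0%N _ _ (iid Q0 n) _ mA.
have [b bE b0] := fin 0%N _ _ (iid Q0 n) _ (measurableC mD).
have [c cE c0] := fin 0%N _ _ (iid Q0 n) _ mAD.
have [e eE e0] := fin 0%N _ _ gamma _ (measurableC mS).
have abc : a <= c + b.
  rewrite -lee_fin EFinD -[X in (X <= _)%E]aE -[X in (_ + X)%E]bE -[X in (X + _)%E]cE.
  apply: (@le_trans _ _ (iid Q0 n ((A `&` D) `|` ~` D))).
    apply: le_measure; rewrite ?inE//.
      by apply: measurableU => //; exact: measurableC.
    by move=> t At; have [Dt|Dt] := pselect (D t); [left|right].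
  apply: (measureU2 (iid Q0 n)) => //; exact: measurableC.
move: bad; rewrite [X in (X + _)%E]bE [X in (_ + X)%E]eE -EFinD lte_fin => bad.
apply: contrapT => noG.
have QGlt G : S G -> (iid (QG G) n A < (a - eta)%:E)%E.
  move=> SG; rewrite ltNge; apply/negP => le; apply: noG; exists G => //.
  by rewrite [X in (X <= _)%E]aE -leeBlDr// -EFinB.
have e1 : e < 1 by lra.
(* A member of S shows that a - eta exceeds a probability, hence is positive; the dominating
   function below is then nonnegative. *)
have [G0 SG0] : exists G, S G.
  apply: contrapT => nS; have S0 : ~` S = setT.
    by apply/seteqP; split => // G _ SG; apply: nS; exists G.
  by move: eE; rewrite S0 [LHS]probability_setT => -[e1']; move: e1; rewrite -e1' ltxx.
have v0 : 0 < a - eta.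
  by rewrite -lte_fin (le_lt_trans _ (QGlt _ SG0)).
have : (c%:E <= (a - eta)%:E + e%:E)%E.
  rewrite -cE -(mixture_iid_QG mAD (@subIsetr _ _ _)).
  apply: (@le_trans _ _ (\int[gamma]_G ((a - eta)%:E + (\1_(~` S) G)%:E))%E).
    apply: ge0_le_integral => //.
    - exact: measurable_iid_QG.
    - apply: emeasurable_funD => //; apply/measurable_EFinP.
      by apply: measurable_indic; exact: measurableC.
    move=> G _; have [SG|nSG] := pselect (S G).
      rewrite indicE memNset//= adde0 ltW// (le_lt_trans _ (QGlt _ SG))//.
      by apply: le_measure; rewrite ?inE.
    rewrite indicE mem_set//= (le_trans (probability_le1 _ mAD))//.
    by rewrite leeDr// lee_fin ltW.
  rewrite ge0_integralD//; last 2 first.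
  - by move=> G _; rewrite lee_fin ltW.
  - by apply/measurable_EFinP/measurable_indic; exact: measurableC.
  rewrite integral_cst// [X in (_ * X)%E]probability_setT mule1.
  rewrite integral_indic//; last exact: measurableC.
  by rewrite setIT [X in (_ + X <= _)%E]eE.
by rewrite -EFinD lee_fin; lra.
Qed.

End sample.

End random_link.

(** * Conditional expectation given the response *)

Section conditional_expectation.
Context d d' (T : measurableType d) (T' : measurableType d') (R : realType).
Variables (P : probability T R) (Y : T -> T').
Hypothesis mY : measurable_fun [set: T] Y.
Implicit Types (X : T -> R) (m : T' -> R).

Let YM : {mfun T >-> T'} := mfun_Sub (mem_set mY).

Lemma ae_distribution (Q : T' -> Prop) :
  {ae distribution P YM, forall y, Q y} -> {ae P, forall w, Q (Y w)}.
Proof.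
move=> [A [mA A0 QA]]; exists (Y @^-1` A); split => //.
- by rewrite -[X in measurable X]setTI; exact: mY.
- by move=> w /= nQ; exact: (QA (Y w)).
Qed.

(** Pushed forward along Y, the two versions have equal integrals over every measurable set, so they
    agree almost everywhere for the law of Y. *)
Lemma is_cond_exp_unique X m1 m2 : is_cond_exp P Y X m1 -> is_cond_exp P Y X m2 ->
  {ae P, forall w, m1 (Y w) = m2 (Y w)}.
Proof.
move=> [mm1 i1 e1] [mm2 i2 e2].
apply: (@ae_distribution (fun y => m1 y = m2 y)).
have mE1 : measurable_fun [set: T'] (EFin \o m1) by exact/measurable_EFinP.
have mE2 : measurable_fun [set: T'] (EFin \o m2) by exact/measurable_EFinP.
have iS m E : measurable E -> P.-integrable setT (EFin \o (m \o Y)) ->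
    P.-integrable (Y @^-1` E) ((EFin \o m) \o Y).
  move=> mE; apply: integrableS => //.
  by rewrite -[X in measurable X]setTI; exact: mY.
have tr m E : measurable_fun [set: T'] (EFin \o m) -> measurable E ->
    P.-integrable setT (EFin \o (m \o Y)) ->
    (\int[distribution P YM]_(y in E) (EFin \o m) y =
     \int[P]_(w in Y @^-1` E) (m (Y w))%:E)%E.
  by move=> mm mE im; apply: (integral_pushforward mY mm (iS _ _ mE im) mE).
have : ae_eq (distribution P YM) setT (EFin \o m1) (EFin \o m2).
  apply: integral_ae_eq => //.
    exact: (integrable_pushforward mY mE1 (iS _ _ measurableT i1) measurableT).
  by move=> E _ mE; rewrite !tr// e1// e2.
by apply: filterS => y /(_ I) [].
Qed.

(** [cond_exp] is a version selected by choice, hence known only up to null sets and only once some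
    version is exhibited. The gSNR is therefore computed from an explicit version. *)
Lemma cond_exp_ae X m : is_cond_exp P Y X m ->
  {ae P, forall w, cond_exp P Y X (Y w) = m (Y w)}.
Proof.
move=> Hm; apply: (is_cond_exp_unique (X := X)) => //.
by rewrite /cond_exp; exact: (xgetPex (cst 0) (ex_intro _ m Hm)).
Qed.

Lemma measurable_cond_exp X m : is_cond_exp P Y X m ->
  measurable_fun [set: T'] (cond_exp P Y X).
Proof. by move=> Hm; have [] := xgetPex (cst 0) (ex_intro _ m Hm). Qed.

Lemma is_cond_expB X1 X2 m1 m2 :
  P.-integrable setT (EFin \o X1) -> P.-integrable setT (EFin \o X2) ->
  is_cond_exp P Y X1 m1 -> is_cond_exp P Y X2 m2 ->
  is_cond_exp P Y (X1 \- X2) (m1 \- m2).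
Proof.
move=> iX1 iX2 [mm1 i1 e1] [mm2 i2 e2].
have mYB B : measurable B -> measurable (Y @^-1` B).
  by move=> mB; rewrite -[X in measurable X]setTI; exact: mY.
have iS (f : T -> R) B : measurable B -> P.-integrable setT (EFin \o f) ->
    P.-integrable (Y @^-1` B) (fun w => (f w)%:E).
  by move=> mB; apply: integrableS => //; exact: mYB.
split; first exact: measurable_funB.
  exact: (integrableB measurableT i1 i2).
move=> B mB.
transitivity (\int[P]_(w in Y @^-1` B) ((m1 (Y w))%:E - (m2 (Y w))%:E))%E.
  by apply: eq_integral => w _; rewrite EFinB.
rewrite (integralB (mYB _ mB) (iS _ _ mB i1) (iS _ _ mB i2)) e1// e2//.
rewrite -(integralB (mYB _ mB) (iS _ _ mB iX1) (iS _ _ mB iX2)).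
by apply: eq_integral => w _; rewrite EFinB.
Qed.

End conditional_expectation.

Section ae_covariance.
Context d (T : measurableType d) (R : realType) (P : probability T R).

Lemma ae_expectation (X Y : T -> R) :
  measurable_fun [set: T] X -> measurable_fun [set: T] Y ->
  {ae P, forall w, X w = Y w} -> ('E_P[X] = 'E_P[Y])%E.
Proof.
move=> mX mY XY; rewrite unlock; apply: ae_eq_integral => //.
- exact/measurable_EFinP.
- exact/measurable_EFinP.
- by apply: filterS XY => w -> _.
Qed.

Lemma ae_covariance (X X' Y Y' : T -> R) :
  measurable_fun [set: T] X -> measurable_fun [set: T] X' ->
  measurable_fun [set: T] Y -> measurable_fun [set: T] Y' ->
  {ae P, forall w, X w = X' w} -> {ae P, forall w, Y w = Y' w} ->
  covariance P X Y = covariance P X' Y'.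
Proof.
move=> mX mX' mY mY' XX' YY'; rewrite unlock.
rewrite (ae_expectation mX mX' XX') (ae_expectation mY mY' YY').
have mB (f : T -> R) c : measurable_fun [set: T] f ->
    measurable_fun [set: T] (f \- cst c) by move=> mf; exact: measurable_funB.
apply: ae_expectation.
- by apply: measurable_funM; exact: mB.
- by apply: measurable_funM; exact: mB.
- by apply: filterS2 XX' YY' => w XX YY; rewrite !fctE/= XX YY.
Qed.

End ae_covariance.

(** * Conditional expectations under a step link *)

Section link_cond_exp.
Context (R : realType) d (X : measurableType d) (mu : probability X R).
Variables (N : nat) (kappa : {mfun X >-> nat}).
Hypothesis kappaN : forall x, (kappa x < N)%N.
Variable G : N.-tuple R.

Local Notation P := (noisy mu (mlink kappaN G) 1).
Local Notation leb := (@lebesgue_measure R).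

Let cell j := kappa @^-1` [set j].

Let mcell j : measurable (cell j).
Proof. by rewrite -[X in measurable X]setTI; exact: (measurable_funPT kappa). Qed.

Lemma ge0_integral_link (f : R -> \bar R) (psi : X -> R) :
  measurable_fun [set: R] f -> (forall y, 0 <= f y)%E ->
  measurable_fun [set: X] psi -> (forall x, 0 <= psi x) ->
  (\int[P]_t (f t.1 * (psi t.2)%:E) =
   \int[mu]_x ((psi x)%:E * \int[normal_prob 0%R 1%R]_e f (link kappa G x + e)%R))%E.
Proof.
move=> mf f0 mpsi psi0.
have mfp : measurable_fun [set: R * X] (fun t => f t.1 * (psi t.2)%:E)%E.
  apply: emeasurable_funM; first exact: (measurableT_comp mf).
  by apply/measurable_EFinP; exact: (measurableT_comp mpsi).
have fp0 (t : R * X) : (0 <= f t.1 * (psi t.2)%:E)%E by rewrite mule_ge0// lee_fin.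
apply: (etrans (ge0_integral_noisy mu (mlink kappaN G) 1 mfp fp0)).
apply: eq_integral => x _ /=.
have mfx : measurable_fun [set: R] (fun e => f (link kappa G x + e)).
  by apply: (measurableT_comp mf); exact: measurable_funD.
rewrite muleC -ge0_integralZr//; last by rewrite lee_fin.
Qed.

Let alpha (psi : X -> R) j := fine (\int[mu]_(x in cell j) (psi x)%:E)%E.
Let mix (psi : X -> R) y := \sum_(j < N) alpha psi j * normal_pdf (tnth G j) 1 y.

(** [mix psi] is the density of the measure sending f to E[f(y) psi(x)]: on cell j, y is N(G_j, 1),
    and psi has integral [alpha psi j]. Its quotient by the density [mix (cst 1)] of y is
    E[psi(x) | y]. *)
Definition link_cond_exp (psi : X -> R) (y : R) := mix psi y / mix (cst 1) y.

Let alpha1 j : alpha (cst 1) j = fine (mu (cell j)).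
Proof.
rewrite /alpha [X in fine X](_ : _ = \int[mu]_(x in cell j) (cst 1%E x))%E//.
by rewrite integral_cst// mul1e.
Qed.

Let alpha1_ge0 j : 0 <= alpha (cst 1) j. Proof. by rewrite alpha1 fine_ge0. Qed.

Section nonnegative.
Variable psi : X -> R.
Hypotheses (mpsi : measurable_fun [set: X] psi) (psi0 : forall x, 0 <= psi x).
Hypothesis psi_lty : (\int[mu]_x (psi x)%:E < +oo)%E.

Let mEpsi D : measurable_fun D (fun x => (psi x)%:E).
Proof. by apply/measurable_EFinP/measurable_funTS. Qed.

Let alpha_ge0 j : 0 <= alpha psi j.
Proof. by apply/fine_ge0/integral_ge0 => x _; rewrite lee_fin. Qed.

Let alphaE j : (\int[mu]_(x in cell j) (psi x)%:E = (alpha psi j)%:E)%E.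
Proof.
rewrite fineK// ge0_fin_numE; last by apply: integral_ge0 => x _; rewrite lee_fin.
apply: le_lt_trans psi_lty; apply: ge0_subset_integral => //.
- by move=> x _; rewrite lee_fin.
Qed.

Lemma mix_ge0 y : 0 <= mix psi y.
Proof. by apply: sumr_ge0 => j _; rewrite mulr_ge0 ?normal_pdf_ge0. Qed.

Lemma measurable_mix : measurable_fun [set: R] (mix psi).
Proof.
apply: measurable_sum => j; apply: measurable_funM => //.
exact: measurable_normal_pdf.
Qed.

(** The integral over x is split by cells; on each cell the link is constant, so the inner integral
    over the noise comes out as a factor. *)
Lemma ge0_integral_mix (f : R -> \bar R) :
  measurable_fun [set: R] f -> (forall y, 0 <= f y)%E ->
  (\int[P]_t (f t.1 * (psi t.2)%:E) = \int[leb]_y (f y * (mix psi y)%:E))%E.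
Proof.
move=> mf f0; rewrite (ge0_integral_link mf f0 mpsi psi0).
pose Phi a := (\int[leb]_y (f y * (normal_pdf a 1 y)%:E))%E.
have Phi0 a : (0 <= Phi a)%E.
  by apply: integral_ge0 => y _; rewrite mule_ge0// lee_fin normal_pdf_ge0.
transitivity (\int[mu]_x \sum_(j < N)
    (((psi \_ (cell j)) x)%:E * Phi (tnth G j)))%E.
  apply: eq_integral => x _.
  rewrite (ge0_integral_normal_shift (link kappa G x) (oner_neq0 R) mf f0).
  rewrite -[X in (_ * X = _)%E]/(Phi (link kappa G x)) (link_tnth kappaN).
  rewrite (bigD1 (Ordinal (kappaN x)))//= big1; last first.
    move=> j jk; rewrite patchE memNset ?mul0e// /cell/= => kj.
    by move/eqP: jk; apply; exact: val_inj.
  by rewrite adde0 patchE (mem_set (erefl (kappa x) : cell (kappa x) x)).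
have mp j : measurable_fun [set: X] (psi \_ (cell j)).
  exact: ((measurable_restrictT psi (mcell j)).1 (measurable_funTS mpsi)).
have p0 j x : 0 <= (psi \_ (cell j)) x by rewrite patchE; case: ifP => _; [exact: psi0|exact: lexx].
rewrite ge0_integral_sum//; last 2 first.
- by move=> j; apply: emeasurable_funM => //; exact/measurable_EFinP.
- by move=> j x _; rewrite mule_ge0// lee_fin.
transitivity (\sum_(j < N) \int[leb]_y (f y * (alpha psi j * normal_pdf (tnth G j) 1 y)%:E))%E.
  apply: eq_bigr => j _; rewrite ge0_integralZr//; last 2 first.
  - exact/measurable_EFinP.
  - by move=> x _; rewrite lee_fin.
  have -> : (\int[mu]_x ((psi \_ (cell j)) x)%:E = (alpha psi j)%:E)%E.
    rewrite -alphaE [RHS]integral_mkcond; apply: eq_integral => x _.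
    by rewrite !patchE; case: ifP.
  rewrite /Phi -ge0_integralZl//; last 3 first.
  - apply: emeasurable_funM => //; apply/measurable_EFinP; exact: measurable_normal_pdf.
  - by move=> y _; rewrite mule_ge0// lee_fin normal_pdf_ge0.
  - by rewrite lee_fin.
  by apply: eq_integral => y _; rewrite EFinM muleCA.
rewrite -ge0_integral_sum//; last 2 first.
- move=> j; apply: emeasurable_funM => //; apply/measurable_EFinP.
  by apply: measurable_funM => //; exact: measurable_normal_pdf.
- by move=> j y _; rewrite mule_ge0// lee_fin mulr_ge0 ?normal_pdf_ge0.
apply: eq_integral => y _; rewrite -ge0_sume_distrr ?sumEFin//.
by move=> j _; rewrite lee_fin mulr_ge0 ?normal_pdf_ge0.
Qed.

Lemma alpha_null j : alpha (cst 1) j = 0 -> alpha psi j = 0.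
Proof.
rewrite alpha1 /alpha => mu0; rewrite null_set_integral//.
by apply/eqP; rewrite -fine_eq0 ?mu0// fin_num_measure.
Qed.

End nonnegative.

Let int1_lty : (\int[mu]_x ((cst 1 : X -> R) x)%:E < +oo)%E.
Proof.
rewrite [X in (X < _)%E](_ : _ = \int[mu]_x (cst 1%E x))%E//.
rewrite integral_cst// mul1e; apply: le_lt_trans (ltry 1).
exact: probability_le1.
Qed.

(** Some cell has positive mass, for otherwise the law of (y, x) would have total mass 0; and a
    normal density vanishes nowhere. *)
Lemma mix1_gt0 y : 0 < mix (cst 1) y.
Proof.
have [j pj] : exists j : 'I_N, 0 < alpha (cst 1) j.
  apply: contrapT => /forallNP nj.
  have a0 (j : 'I_N) : alpha (cst 1) j = 0.
    by apply/eqP; rewrite eq_le alpha1_ge0 andbT leNgt; apply/negP/nj.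
  have E := ge0_integral_mix (measurable_cst (1 : R)) (fun=> ler01) int1_lty
    (measurable_cst (1%E : \bar R)) (fun=> lee01).
  have L1 : (\int[P]_t (cst 1 t.1 * ((cst 1 : X -> R) t.2)%:E) = 1)%E.
    transitivity (\int[P]_t (cst 1%E t))%E.
      by apply: eq_integral => t _; rewrite mule1.
    by rewrite integral_cst// mul1e; exact: probability_setT.
  have R0 : (\int[leb]_y (cst 1 y * (mix (cst 1) y)%:E) = 0)%E.
    apply: integral0_eq => z _; rewrite /mix big1 ?mule0// => j _.
    by rewrite a0 mul0r.
  have /eqP := etrans (esym L1) (etrans E R0).
  by rewrite onee_eq0.
rewrite /mix (bigD1 j)//=; apply: ltr_wpDr.
  by apply: sumr_ge0 => i _; rewrite mulr_ge0 ?normal_pdf_ge0.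
by rewrite mulr_gt0// normal_pdf_gt0 ?oner_neq0.
Qed.

Section nonnegative_cond_exp.
Variable psi : X -> R.
Hypotheses (mpsi : measurable_fun [set: X] psi) (psi0 : forall x, 0 <= psi x).
Hypothesis psi_lty : (\int[mu]_x (psi x)%:E < +oo)%E.

Lemma measurable_link_cond_exp : measurable_fun [set: R] (link_cond_exp psi).
Proof.
apply: measurable_funM; first exact: measurable_mix.
rewrite (_ : (fun y => _) = (fun y => expR (- ln (mix (cst 1) y)))); last first.
  by apply/funext => y; rewrite expRN lnK// posrE mix1_gt0.
apply: measurableT_comp => //; apply: measurableT_comp => //.
by apply: measurableT_comp; [exact: measurable_ln|exact: measurable_mix].
Qed.

Lemma link_cond_exp_ge0 y : 0 <= link_cond_exp psi y.
Proof. by rewrite divr_ge0 ?mix_ge0. Qed.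

(** Two mixtures of the same densities have a ratio bounded by the largest ratio of weights, hence
    by their sum. Boundedness yields integrability here and a finite second moment later. *)
Lemma link_cond_exp_bounded : exists C, forall y, link_cond_exp psi y <= C.
Proof.
have a0 j : 0 <= alpha psi j.
  by apply/fine_ge0/integral_ge0 => x _; rewrite lee_fin.
pose C := \sum_(j < N) alpha psi j / alpha (cst 1) j.
have C0 (j : 'I_N) : alpha psi j / alpha (cst 1) j <= C.
  rewrite /C (bigD1 j)//= lerDl; apply: sumr_ge0 => i _.
  by rewrite divr_ge0.
exists C => y; rewrite ler_pdivrMr ?mix1_gt0// /mix mulr_sumr.
apply: ler_sum => j _; rewrite mulrA ler_wpM2r ?normal_pdf_ge0//.
(* A cell of mass zero has a zero denominator, but its numerator vanishes as well. *)
have [a10|a1N] := eqVneq (alpha (cst 1) j) 0.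
  by rewrite (alpha_null mpsi a10) a10 mulr0.
by rewrite -ler_pdivrMr ?lt_def ?a1N ?alpha1_ge0.
Qed.

Lemma ge0_integral_link_snd :
  (\int[P]_t (psi t.2)%:E = \int[mu]_x (psi x)%:E)%E.
Proof.
have E := ge0_integral_link (measurable_cst (1%E : \bar R)) (fun=> lee01) mpsi psi0.
transitivity (\int[P]_t (cst 1 t.1 * (psi t.2)%:E))%E.
  by apply: eq_integral => t _; rewrite mul1e.
apply: (etrans E); apply: eq_integral => x _; rewrite integral_cst// mul1e.
by rewrite [X in (_ * X)%E](_ : _ = 1%E) ?mule1//; exact: probability_setT.
Qed.

Lemma integrable_link_snd : P.-integrable setT (EFin \o (fun t => psi t.2)).
Proof.
apply/integrableP; split.
  by apply/measurable_EFinP; exact: (measurableT_comp mpsi).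
apply: le_lt_trans psi_lty; rewrite -ge0_integral_link_snd.
rewrite le_eqVlt; apply/orP; left; apply/eqP.
by apply: eq_integral => t _ /=; rewrite ger0_norm.
Qed.

Lemma is_cond_exp_link :
  is_cond_exp P fst (fun t => psi t.2) (link_cond_exp psi).
Proof.
have mm := measurable_link_cond_exp.
have [C mC] := link_cond_exp_bounded.
split => //.
  apply: (@le_integrable _ _ _ P setT measurableT _ (cst C%:E)).
  - by apply/measurable_EFinP; exact: (measurableT_comp mm).
  - move=> t _ /=; rewrite lee_fin !ger0_norm ?link_cond_exp_ge0//.
    exact: (le_trans (link_cond_exp_ge0 t.1)).
  - exact: finite_measure_integrable_cst.
move=> B mB.
have mB1 : measurable_fun [set: R] (fun y => (\1_B y : R)%:E).
  exact/measurable_EFinP.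
have mBm : measurable_fun [set: R] (fun y => (\1_B y * link_cond_exp psi y)%:E).
  by apply/measurable_EFinP; exact: measurable_funM.
have B0 y : (0 <= (\1_B y : R)%:E)%E by rewrite lee_fin.
have Bm0 y : (0 <= (\1_B y * link_cond_exp psi y)%:E)%E.
  by rewrite lee_fin mulr_ge0 ?link_cond_exp_ge0.
have E1 := @ge0_integral_mix (cst 1) (measurable_cst _) (fun=> ler01) int1_lty _ mBm Bm0.
have E2 := ge0_integral_mix mpsi psi0 psi_lty mB1 B0.
transitivity (\int[P]_t ((\1_B t.1 * link_cond_exp psi t.1)%:E * ((cst 1 : X -> R) t.2)%:E))%E.
  rewrite integral_mkcond; apply: eq_integral => t _.
  by rewrite patchE mule1 indicE; case: (boolP (t.1 \in B)) => tB;
    [rewrite mem_set ?mul1r//; exact: set_mem tB | rewrite memNset ?mul0r// => ?; move/negP: tB; apply; rewrite inE].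
apply: (etrans E1); apply: etrans; last first.
  transitivity (\int[P]_t ((\1_B t.1)%:E * (psi t.2)%:E))%E; last first.
    rewrite [RHS]integral_mkcond; apply: eq_integral => t _.
    by rewrite patchE indicE; case: (boolP (t.1 \in B)) => tB;
      [rewrite mem_set ?mul1e//; exact: set_mem tB | rewrite memNset ?mul0e// => ?; move/negP: tB; apply; rewrite inE].
  exact/esym/E2.
apply: eq_integral => y _; rewrite -!EFinM -mulrA divfK// gt_eqF// mix1_gt0//.
Qed.

(** If psi has the same mean on every cell, its numerator mixture is proportional to the density of
    y. This disposes of the coordinates of x that do not determine the cell. *)
Lemma link_cond_exp_cst c :
  (forall j, \int[mu]_(x in cell j) (psi x)%:E = c%:E * mu (cell j))%E ->
  link_cond_exp psi = cst c.
Proof.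
move=> Hc; apply/funext => y; rewrite /link_cond_exp.
suff -> : mix psi y = c * mix (cst 1) y by rewrite mulfK// gt_eqF// mix1_gt0.
rewrite /mix mulr_sumr; apply: eq_bigr => j _; rewrite mulrA; congr (_ * _).
by rewrite alpha1 /alpha Hc fineM// fin_num_measure.
Qed.

Variables (pos : pred nat) (r : R).

(** The responses from which one would guess that x lies in a cell selected by [pos], later the
    cells of positive first coordinate. *)
Definition near_set : set R := [set y | exists2 j : 'I_N, pos j & `|y - tnth G j| <= r].

Lemma measurable_near_set : measurable near_set.
Proof.
rewrite (_ : near_set = \bigcup_(j in [set j : 'I_N | pos j])
    `[tnth G j - r, tnth G j + r]%classic).
  apply: fin_bigcup_measurable => // j _; exact: measurable_itv.
apply/seteqP; split => y [j pj]; rewrite /= ?in_itv/= => yj; exists j => //=.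
  by rewrite in_itv/= -ler_distl.
by rewrite ler_distl.
Qed.

Let mnear : measurable_fun [set: R] (fun y => (\1_near_set y : R)%:E).
Proof. by apply/measurable_EFinP/measurable_indic; exact: measurable_near_set. Qed.

Let near0 y : (0 <= (\1_near_set y : R)%:E)%E. Proof. by rewrite lee_fin. Qed.

Let mshift a : measurable [set e : R | near_set (a + e)].
Proof.
have mf : measurable_fun [set: measurableTypeR R] (fun e : R => a + e).
  exact: measurable_funD.
by have := mf measurableT _ measurable_near_set; rewrite setTI.
Qed.

Let int_near : (\int[P]_t ((\1_near_set t.1)%:E * (psi t.2)%:E) =
  \int[mu]_x ((psi x)%:E *
    normal_prob 0%R 1%R [set e : R | near_set (link kappa G x + e)%R]))%E.
Proof.
apply: (etrans (ge0_integral_link mnear near0 mpsi psi0)).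
apply: eq_integral => x _; congr (_ * _)%E.
transitivity (\int[normal_prob 0%R 1%R]_e
    (\1_[set e : R | near_set (link kappa G x + e)%R] e)%:E)%E.
  by apply: eq_integral => e _; rewrite !indicE.
by rewrite integral_indic ?setIT//; exact: mshift.
Qed.

Let mhit : measurable_fun [set: X] (fun x => (psi x)%:E *
  normal_prob 0%R 1%R [set e : R | near_set (link kappa G x + e)%R])%E.
Proof.
apply: emeasurable_funM; first exact/measurable_EFinP.
pose f (u : X * measurableTypeR R) : \bar R :=
  (\1_near_set (link kappa G u.1 + u.2)%R)%:E.
have mf : measurable_fun [set: X * measurableTypeR R] f.
  apply: (measurableT_comp mnear); apply: measurable_funD => //.
  by apply: (measurableT_comp (measurable_link1 kappaN G)).
have f0 u : (0 <= f u)%E by exact: near0.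
have := measurable_fun_fubini_tonelli_F (m2 := normal_prob 0%R 1%R) f mf f0.
apply: eq_measurable_fun => x _; rewrite /fubini_F.
transitivity (\int[normal_prob 0%R 1%R]_e
    (\1_[set e : R | near_set (link kappa G x + e)%R] e)%:E)%E.
  by apply: eq_integral => e _; rewrite /f !indicE.
by rewrite integral_indic ?setIT//; exact: mshift.
Qed.

(** Where psi is positive, the level of x is itself a selected one, so noise of size at most r keeps
    y in the set. *)
Lemma link_hit q : (0 <= q)%R ->
  (forall x, 0 < psi x -> pos (kappa x)) ->
  (q%:E <= normal_prob 0%R 1%R [set e : R | (`|e| <= r)%R])%E ->
  (q%:E * \int[mu]_x (psi x)%:E <=
   \int[P]_t ((\1_near_set t.1)%:E * (psi t.2)%:E))%E.
Proof.
move=> q0 ppos qr; rewrite int_near -ge0_integralZl//;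
  [|exact/measurable_EFinP|by move=> x _; rewrite lee_fin].
apply: ge0_le_integral => //.
- by move=> x _; rewrite mule_ge0 ?lee_fin.
- by apply: measurable_funeM; exact/measurable_EFinP.
move=> x _; rewrite muleC.
have [psix|psix] := ltP 0 (psi x); last first.
  have -> : psi x = 0 by apply/eqP; rewrite eq_le psix psi0.
  by rewrite !mul0e.
rewrite lee_wpmul2l ?lee_fin// (le_trans qr)//; apply: le_measure.
- rewrite inE (_ : [set e | _] = (fun e : R => `|e|) @^-1` `]-oo, r]%classic).
    by rewrite -[X in measurable X]setTI; exact: normr_measurable.
  by apply/seteqP; split => e /=; rewrite in_itv.
- by rewrite inE; exact: mshift.
move=> e /= er; exists (Ordinal (kappaN x)); first exact: ppos.
by rewrite -link_tnth addrC addKr.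
Qed.

(** Where psi is positive, the level of x is not selected, hence more than 2r away from every
    selected level: y can enter the set only if the noise exceeds r. *)
Lemma link_miss q : (0 <= q)%R ->
  (forall x, 0 < psi x -> ~~ pos (kappa x)) ->
  collision_free (fun a b : R => `|a - b| <= r *+ 2) N G ->
  (normal_prob 0%R 1%R [set e : R | (r <= `|e|)%R] <= q%:E)%E ->
  (\int[P]_t ((\1_near_set t.1)%:E * (psi t.2)%:E) <=
   q%:E * \int[mu]_x (psi x)%:E)%E.
Proof.
move=> q0 ppos Gr qr; rewrite int_near -ge0_integralZl//;
  [|exact/measurable_EFinP|by move=> x _; rewrite lee_fin].
apply: ge0_le_integral => //.
- by move=> x _; rewrite mule_ge0 ?lee_fin.
- by apply: measurable_funeM; exact/measurable_EFinP.
move=> x _; rewrite [leRHS]muleC.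
have [psix|psix] := ltP 0 (psi x); last first.
  have -> : psi x = 0 by apply/eqP; rewrite eq_le psix psi0.
  by rewrite !mul0e.
rewrite lee_wpmul2l ?lee_fin//; apply: le_trans qr; apply: le_measure.
- by rewrite inE; exact: mshift.
- rewrite inE (_ : [set e | _] = (fun e : R => `|e|) @^-1` `[r, +oo[%classic).
    by rewrite -[X in measurable X]setTI; exact: normr_measurable.
  by apply/seteqP; split => e /=; rewrite in_itv/= andbT.
move=> e /= [j pj]; rewrite (link_tnth kappaN) => ej.
have jk : Ordinal (kappaN x) != j.
  by apply: contraNneq (ppos _ psix) => /(congr1 val)/= ->.
have /= := Gr _ _ jk; rewrite -ltNge => far.
rewrite leNgt; apply/negP => er; move: far; apply/negP; rewrite -leNgt.
(* The gap between the levels is the distance from y to level j corrected by the noise; were both at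
   most r, the gap could not exceed 2r. *)
have -> : tnth G (Ordinal (kappaN x)) - tnth G j =
  (tnth G (Ordinal (kappaN x)) + e - tnth G j) - e by ring.
by rewrite (le_trans (ler_normB _ _))// mulr2n lerD// ltW.
Qed.

End nonnegative_cond_exp.

End link_cond_exp.

(** * Generalized signal-to-noise ratio *)

Section gaussian.
Context (R : realType).

Definition gauss_map p (A : 'M[R]_p) (z : p.-tuple (measurableTypeR R)) :
  p.-tuple R := apply_mx A z.

Lemma measurable_gauss_map p (A : 'M[R]_p) :
  measurable_fun [set: p.-tuple (measurableTypeR R)] (gauss_map A).
Proof.
apply/measurable_fun_tnthP => i.
rewrite (_ : _ \o _ = fun z => \sum_(k < p) A i k * tnth z k); last first.
  apply/funext => z /=; rewrite tnth_mktuple /dot.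
  by apply: eq_bigr => k _; rewrite mxE.
apply: measurable_sum => k; apply: measurable_funM => //.
exact: measurable_tnth.
Qed.

HB.instance Definition _ p (A : 'M[R]_p) :=
  isMeasurableFun.Build _ _ _ _ (gauss_map A) (@measurable_gauss_map p A).

Definition gaussian p (A : 'M[R]_p) : probability (p.-tuple R) R :=
  distribution (iid (normal_prob (0 : R) 1) p) (gauss_map A).

Lemma is_mvnormal_gaussian p (A : 'M[R]_p) : is_mvnormal (A *m A^T) (gaussian A).
Proof. by exists A. Qed.

Lemma tnth_apply_scalar p (a : R) (z : p.-tuple R) i :
  tnth (apply_mx a%:M z) i = a * tnth z i.
Proof.
rewrite tnth_mktuple /dot (bigD1 i)//= big1 ?addr0; first by rewrite !mxE eqxx.
by move=> k ki; rewrite !mxE eq_sym (negbTE ki) mul0r.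
Qed.

Section scalar.
Variables (p : nat) (a : R).
Local Notation mu := (@gaussian p.+1 a%:M).
Local Notation N01 := (normal_prob (0 : R) 1).

Lemma ge0_integral_gaussian (f : p.+1.-tuple R -> \bar R) :
  measurable_fun [set: p.+1.-tuple R] f -> (forall x, 0 <= f x)%E ->
  (\int[mu]_x f x = \int[iid N01 p.+1]_z f (apply_mx a%:M z))%E.
Proof. by move=> mf f0; rewrite ge0_integral_distribution. Qed.

Let integral_prod (F : 'I_p.+1 -> R -> R) :
  (forall i, measurable_fun [set: R] (F i)) -> (forall i x, 0 <= F i x) ->
  (\int[mu]_x (\prod_(i < p.+1) F i (tnth x i))%:E =
   \prod_(i < p.+1) \int[N01]_z (F i (a * z))%:E)%E.
Proof.
move=> mF F0; rewrite ge0_integral_gaussian; last 2 first.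
- by apply/measurable_EFinP; exact: measurable_prod_tnth.
- by move=> x; rewrite lee_fin prodr_ge0.
transitivity (\int[iid N01 p.+1]_z (\prod_(i < p.+1) F i (a * tnth z i))%:E)%E.
  apply: eq_integral => z _; congr EFin; apply: eq_bigr => i _.
  by rewrite tnth_apply_scalar.
apply: (@ge0_integral_iid_prod _ (measurableTypeR R) R N01 p.+1
  (fun i z => F i (a * z))) => //.
by move=> i; apply: (measurableT_comp (mF i)); exact: measurable_funM.
Qed.

Let int1 : (\int[N01]_z (1%R)%:E = 1 :> \bar R)%E.
Proof. by rewrite integral_cst// mul1e; exact: probability_setT. Qed.

Lemma gaussian_coord (psi : R -> R) i :
  measurable_fun [set: R] psi -> (forall x, 0 <= psi x) ->
  (\int[mu]_x (psi (tnth x i))%:E = \int[N01]_z (psi (a * z))%:E)%E.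
Proof.
move=> mpsi psi0; pose F k : R -> R := if k == i then psi else cst 1.
have := @integral_prod F.
under eq_integral.
  move=> x _; rewrite (bigD1 i)//= big1; last first.
    by move=> k /negbTE ki; rewrite /F ki.
  rewrite mulr1 {1}/F eqxx; over.
move=> ->.
- rewrite (bigD1 i)//= big1 ?mule1; last first.
    by move=> k /negbTE ki; rewrite /F ki.
  by rewrite /F eqxx.
- by move=> k; rewrite /F; case: ifP.
- by move=> k x; rewrite /F; case: ifP.
Qed.

Lemma gaussian_coord2 (phi psi : R -> R) i : i != ord0 ->
  measurable_fun [set: R] phi -> (forall x, 0 <= phi x) ->
  measurable_fun [set: R] psi -> (forall x, 0 <= psi x) ->
  (\int[mu]_x (phi (tnth x ord0) * psi (tnth x i))%:E =
   \int[N01]_z (phi (a * z))%:E * \int[N01]_z (psi (a * z))%:E)%E.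
Proof.
move=> i0 mphi phi0 mpsi psi0.
pose F k : R -> R := if k == ord0 then phi else if k == i then psi else cst 1.
have := @integral_prod F.
under eq_integral.
  move=> x _; rewrite (bigD1 ord0)//= (bigD1 i)//= big1; last first.
    by move=> k /andP[/negbTE k0 /negbTE ki]; rewrite /F k0 ki.
  rewrite mulr1 {1}/F eqxx {1}/F (negbTE i0) eqxx; over.
move=> ->.
- rewrite (bigD1 ord0)//= (bigD1 i)//= big1 ?mule1; last first.
    by move=> k /andP[/negbTE k0 /negbTE ki]; rewrite /F k0 ki.
  by rewrite /F eqxx (negbTE i0) eqxx.
- by move=> k; rewrite /F; case: ifP => // _; case: ifP.
- by move=> k x; rewrite /F; case: ifP => // _; case: ifP.
Qed.

Hypothesis a0 : 0 < a.

(** Half of the mean absolute value of a standard normal variable. *)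
Definition half_mean := fine (\int[N01]_z (Num.max z 0)%:E)%E.

Let mmax : measurable_fun [set: R] (fun x : R => Num.max x 0).
Proof. exact: measurable_maxr. Qed.

Lemma half_meanE : (\int[N01]_z (Num.max z 0)%:E = half_mean%:E)%E.
Proof.
rewrite fineK// ge0_fin_numE; last first.
  by apply: integral_ge0 => z _; rewrite lee_fin le_max lexx orbT.
apply: le_lt_trans (normal_abs_lty R); apply: ge0_le_integral => //.
- by move=> z _; rewrite lee_fin le_max lexx orbT.
- exact/measurable_EFinP.
- by apply/measurable_EFinP; exact: normr_measurable.
- by move=> z _; rewrite lee_fin ge_max ler_norm normr_ge0.
Qed.

Lemma half_mean_gt0 : 0 < half_mean.
Proof. by rewrite -lte_fin -half_meanE normal_pos_gt0. Qed.

(** The positive part for [true], the negative part for [false]: conditional expectations are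
    computed for nonnegative functions and then subtracted. *)
Definition posneg (b : bool) (x : R) := Num.max (if b then x else - x) 0.

Lemma posneg_ge0 b x : 0 <= posneg b x.
Proof. by rewrite le_max lexx orbT. Qed.

Lemma posnegB x : posneg true x - posneg false x = x.
Proof.
rewrite /posneg; have [x0|x0] := leP 0 x.
  have /max_idPr -> : - x <= 0 by rewrite oppr_le0.
  by rewrite subr0.
have /max_idPl -> : 0 <= - x by rewrite oppr_ge0 ltW.
by rewrite sub0r opprK.
Qed.

Lemma measurable_posneg b : measurable_fun [set: R] (posneg b).
Proof.
apply: (measurableT_comp mmax); case: b => //; exact: oppr_measurable.
Qed.

Lemma integral_posneg b : (\int[N01]_z (posneg b (a * z))%:E = (a * half_mean)%:E)%E.
Proof.
have Et : (\int[N01]_z (posneg true (a * z))%:E = (a * half_mean)%:E)%E.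
  rewrite EFinM -half_meanE -ge0_integralZl//; last 3 first.
  - exact/measurable_EFinP.
  - by move=> z _; rewrite lee_fin le_max lexx orbT.
  - by rewrite lee_fin ltW.
  apply: eq_integral => z _; rewrite -EFinM /posneg.
  by rewrite maxr_pMr ?ltW// mulr0.
case: b => //; rewrite -Et.
have mt : measurable_fun [set: R] (fun z => (posneg true (a * z))%:E).
  apply/measurable_EFinP; apply: (measurableT_comp (measurable_posneg true)).
  exact: measurable_funM.
have t0 z : (0 <= (posneg true (a * z))%:E)%E by rewrite lee_fin posneg_ge0.
apply/esym; apply: etrans; first exact/esym/(ge0_integral_normal_opp (oner_neq0 R) mt t0).
by apply: eq_integral => z _; rewrite /posneg mulrN.
Qed.

End scalar.
End gaussian.

(** The first basis vector is an eigenvector for the corner entry. Any other eigenvalue is 0, so the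
    nonnegative corner bounds the spectrum, as the supremum requires. *)
Lemma lambda_max_corner (R : realType) p (M : 'M[R]_p.+1) :
  0 <= M ord0 ord0 ->
  (forall i j, (i != ord0) || (j != ord0) -> M i j = 0) ->
  M ord0 ord0 <= lambda_max M.
Proof.
move=> V0 M0; set V := M ord0 ord0 in V0 *.
have MV (v : 'rV[R]_p.+1) j : (v *m M) ord0 j = if j == ord0 then v ord0 ord0 * V else 0.
  rewrite mxE (bigD1 ord0)//= big1 ?addr0; last by move=> i i0; rewrite M0 ?i0// mulr0.
  by case: eqP => [->//|/eqP j0]; rewrite M0 ?j0 ?orbT// mulr0.
apply: ub_le_sup; last first.
  apply/eigenvalueP; exists (delta_mx ord0 ord0).
    apply/rowP => j; rewrite MV !mxE !eqxx/= mul1r.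
    by case: eqP => _; rewrite ?mulr1 ?mulr0.
  by apply/eqP => /matrixP/(_ ord0 ord0); rewrite !mxE eqxx => /eqP; rewrite oner_eq0.
exists V => b /eigenvalueP[v vM v0].
have E j : (if j == ord0 then v ord0 ord0 * V else 0) = b * v ord0 j.
  by rewrite -MV vM mxE.
have [v00|v00] := eqVneq (v ord0 ord0) 0; last first.
  by have := E ord0; rewrite eqxx mulrC => /(mulIf v00) ->.
have [j vj] : exists j, v ord0 j != 0.
  apply/existsP; apply: contraNT v0; rewrite negb_exists => /forallP v0.
  by apply/eqP/rowP => j; rewrite mxE; apply/eqP/negPn.
have j0 : j != ord0 by apply: contraNneq vj => ->; rewrite v00.
have /eqP := E j; rewrite (negbTE j0) eq_sym mulf_eq0 (negbTE vj) orbF => /eqP ->.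
exact: V0.
Qed.

Section gSNR_bound.
Context (R : realType) (p : nat) (c : R) (k : {mfun R >-> nat}) (N : nat).
Hypotheses (c0 : 0 < c) (kN : forall x, (k x < N)%N).
Local Notation X := (p.+1.-tuple R).

Definition cell_of (x : X) : nat := k (tnth x ord0).

Lemma measurable_cell_of : measurable_fun [set: X] cell_of.
Proof. exact: (measurableT_comp (measurable_funPT k) (measurable_tnth ord0)). Qed.

HB.instance Definition _ :=
  isMeasurableFun.Build _ _ _ _ cell_of measurable_cell_of.

Lemma cell_ofN x : (cell_of x < N)%N. Proof. exact: kN. Qed.

Local Notation mu := (@gaussian R p.+1 (Num.sqrt c)%:M).

Variable G : N.-tuple R.
Local Notation P := (noisy mu (mlink cell_ofN G) 1).

Let a := Num.sqrt c.
Let a0 : 0 < a. Proof. by rewrite sqrtr_gt0. Qed.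
Let psi b (i : 'I_p.+1) (x : X) := posneg b (tnth x i).

Let mpsi b i : measurable_fun [set: X] (psi b i).
Proof. by apply: (measurableT_comp (@measurable_posneg R b)); exact: measurable_tnth. Qed.

Let psi0 b i x : 0 <= psi b i x. Proof. exact: posneg_ge0. Qed.

Let e0 := a * half_mean R.

Let psiE b i : (\int[mu]_x (psi b i x)%:E = e0%:E)%E.
Proof.
rewrite (gaussian_coord _ _ (@measurable_posneg R b) (@posneg_ge0 R b)).
exact: integral_posneg.
Qed.

Let psi_lty b i : (\int[mu]_x (psi b i x)%:E < +oo)%E.
Proof. by rewrite psiE ltry. Qed.

Let m b i := link_cond_exp mu cell_of G (psi b i).
Let mi i := m true i \- m false i.

Let is_cond_exp_mi i : is_cond_exp P fst (fun t => tnth t.2 i) (mi i).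
Proof.
have iP b := integrable_link_snd (mu := mu) cell_ofN G (mpsi b i) (psi0 b i) (psi_lty b i).
have cP b := is_cond_exp_link (mu := mu) cell_ofN G (mpsi b i) (psi0 b i) (psi_lty b i).
have := is_cond_expB measurable_fst (iP true) (iP false) (cP true) (cP false).
rewrite (_ : _ \- _ = fun t => tnth t.2 i)//; apply/funext => t; exact: posnegB.
Qed.

(** Such a coordinate is independent of the first one and so of the cell; both its parts have mean
    [e0] on every cell, and they cancel. *)
Let mi_cst i : i != ord0 -> mi i = cst 0.
Proof.
move=> i0; have mE b : m b i = cst e0.
  apply: (link_cond_exp_cst cell_ofN G) => j.
  pose phi : R -> R := \1_(k @^-1` [set j]).
  have mphi : measurable_fun [set: R] phi.
    apply: measurable_indic; rewrite -[X in measurable X]setTI.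
    exact: (measurable_funPT k).
  have phi0 x : 0 <= phi x by rewrite /phi.
  have phiE x : phi (tnth x ord0) = \1_(cell_of @^-1` [set j]) x by rewrite /phi !indicE.
  have mcell : measurable (cell_of @^-1` [set j]).
    by rewrite -[X in measurable X]setTI; exact: measurable_cell_of.
  transitivity (\int[mu]_x (phi (tnth x ord0) * posneg b (tnth x i))%:E)%E.
    rewrite integral_mkcond; apply: eq_integral => x _.
    rewrite patchE phiE indicE /psi; case: (x \in _); first by rewrite mul1r.
    by rewrite mul0r.
  rewrite (gaussian_coord2 _ i0 mphi phi0 (@measurable_posneg R b) (@posneg_ge0 R b)).
  rewrite (integral_posneg a0) muleC; congr (_ * _)%E.
  rewrite -(@gaussian_coord R p (Num.sqrt c) phi ord0 mphi phi0).
  under eq_integral do rewrite phiE.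
  by rewrite integral_indic// setIT.
by rewrite /mi !mE; apply/funext => y /=; rewrite subrr.
Qed.

Variables (pos : pred nat) (r : R).
Hypothesis pos_gt0 : forall x, 0 < x -> pos (k x).
Hypothesis pos_lt0 : forall x, x < 0 -> ~~ pos (k x).
Hypothesis tail_r : (normal_prob (0 : R) 1 [set e : R | (r <= `|e|)%R] <= (4^-1)%:E)%E.
Hypothesis G_sep : collision_free (fun x y : R => `|x - y| <= r *+ 2) N G.

Let B := near_set G pos r.
Let mB : measurable B. Proof. exact: measurable_near_set. Qed.

Let head_r : ((3 / 4)%:E <= normal_prob (0 : R) 1 [set e : R | (`|e| <= r)%R])%E.
Proof.
have mr : measurable [set e : R | r <= `|e|].
  rewrite (_ : [set e | _] = (fun e : R => `|e|) @^-1` `[r, +oo[%classic).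
    by rewrite -[X in measurable X]setTI; exact: normr_measurable.
  by apply/seteqP; split => e /=; rewrite in_itv/= andbT.
have ml : measurable [set e : R | `|e| <= r].
  rewrite (_ : [set e | _] = (fun e : R => `|e|) @^-1` `]-oo, r]%classic).
    by rewrite -[X in measurable X]setTI; exact: normr_measurable.
  by apply/seteqP; split => e /=; rewrite in_itv.
apply: (@le_trans _ _ (normal_prob (0 : R) 1 (~` [set e : R | r <= `|e|]))).
  rewrite probability_setC//; apply: le_trans (leeB (lexx 1%E) tail_r).
  by rewrite -EFinB lee_fin; lra.
apply: le_measure; rewrite ?inE//; first exact: measurableC.
by move=> e /= /negP; rewrite -ltNge => /ltW.
Qed.

Let int_coord D : measurable D ->
  (\int[P]_(t in fst @^-1` D) (tnth t.2 ord0)%:E =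
   \int[P]_t ((\1_D t.1)%:E * (psi true ord0 t.2)%:E) -
   \int[P]_t ((\1_D t.1)%:E * (psi false ord0 t.2)%:E))%E.
Proof.
move=> mD; have mD' : measurable (fst @^-1` D : set (R * X)).
  by rewrite -[X in measurable X]setTI; exact: measurable_fst.
have iP b : P.-integrable (fst @^-1` D) (fun t => (psi b ord0 t.2)%:E).
  apply: (integrableS measurableT) => //.
  exact: (integrable_link_snd (mu := mu) cell_ofN G (mpsi b _) (psi0 b _) (psi_lty b _)).
transitivity (\int[P]_(t in fst @^-1` D)
    ((psi true ord0 t.2)%:E - (psi false ord0 t.2)%:E))%E.
  by apply: eq_integral => t _; rewrite -EFinB /psi posnegB.
rewrite integralB//; congr (_ - _)%E; rewrite integral_mkcond; apply: eq_integral => t _;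
  rewrite patchE indicE (_ : (t \in _) = (t.1 \in D)) ?[t \in _]mem_setE//;
  by case: (t.1 \in D); rewrite ?mul1e ?mul0e.
Qed.

Let int_mi D : measurable D ->
  (\int[P]_(t in fst @^-1` D) (mi ord0 t.1)%:E =
   \int[P]_(t in fst @^-1` D) (tnth t.2 ord0)%:E)%E.
Proof. by have [_ _] := is_cond_exp_mi ord0; apply. Qed.

Let mean_mi : ('E_P[mi ord0 \o fst] = 0)%E.
Proof.
rewrite unlock -[integral _ _ _]/(\int[P]_(t in fst @^-1` setT) (mi ord0 t.1)%:E)%E.
rewrite int_mi// int_coord//.
have E b : (\int[P]_t ((\1_[set: R] t.1)%:E * (psi b ord0 t.2)%:E) = e0%:E)%E.
  under eq_integral do rewrite indicT mul1e.
  by rewrite (ge0_integral_link_snd mu cell_ofN G (mpsi _ _) (psi0 _ _)) psiE.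
by rewrite !E subee.
Qed.

(** The positive part of the first coordinate contributes at least 3/4 of its mean, by [link_hit],
    and the negative part at most 1/4 of the same mean, by [link_miss]. *)
Let int_mi_B : ((e0 / 2)%:E <= \int[P]_(t in fst @^-1` B) (mi ord0 t.1)%:E)%E.
Proof.
rewrite int_mi// int_coord//.
have hit : ((3 / 4)%:E * e0%:E <= \int[P]_t ((\1_B t.1)%:E * (psi true ord0 t.2)%:E))%E.
  rewrite -(psiE true ord0); apply: link_hit => //.
  move=> x; rewrite /psi/posneg lt_max ltxx orbF; exact: pos_gt0.
have miss : (\int[P]_t ((\1_B t.1)%:E * (psi false ord0 t.2)%:E) <= (4^-1)%:E * e0%:E)%E.
  rewrite -(psiE false ord0); apply: link_miss => //.
  by move=> x; rewrite /psi/posneg lt_max ltxx orbF oppr_gt0; exact: pos_lt0.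
apply: le_trans (leeB hit miss).
by rewrite -!EFinM -EFinB lee_fin; lra.
Qed.

Let mmi i : measurable_fun [set: R] (mi i).
Proof. by have [] := is_cond_exp_mi i. Qed.

Let mmf i : measurable_fun [set: R * X] (mi i \o fst).
Proof. exact: (measurableT_comp (mmi i) measurable_fst). Qed.

Let mi_sq_lty : (\int[P]_t (mi ord0 t.1 ^+ 2)%:E < +oo)%E.
Proof.
have bd b := link_cond_exp_bounded mu cell_ofN G (mpsi b ord0) (psi0 b ord0).
have [C1 mC1] := bd true; have [C2 mC2] := bd false.
have m0 b y : 0 <= m b ord0 y by apply: link_cond_exp_ge0 => //; exact: psi0.
apply: (@le_lt_trans _ _ (\int[P]_t (cst ((C1 + C2) ^+ 2)%:E t))%E); last first.
  rewrite integral_cst//= [X in (_ * X)%E](_ : _ = 1%E) ?mule1 ?ltry//.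
  exact: probability_setT.
apply: ge0_le_integral => //.
- by move=> t _; rewrite lee_fin sqr_ge0.
- by apply/measurable_EFinP; apply: measurable_funX; exact: mmf.
move=> t _; rewrite lee_fin /mi/=.
have := m0 true t.1; have := m0 false t.1; have := mC1 t.1; have := mC2 t.1.
rewrite -/(m true ord0) -/(m false ord0); nra.
Qed.

(** Cauchy-Schwarz in tangent form: m^2 >= 2 t m - t^2 is integrated over the event that y lies in
    [B], with t = e0 / 2. The first term gives at least 2 t^2, and the event has probability at most
    1. *)
Let mi_sq_ge : (((e0 / 2) ^+ 2)%:E <= \int[P]_t (mi ord0 t.1 ^+ 2)%:E)%E.
Proof.
pose D : set (R * X) := fst @^-1` B; pose t := e0 / 2.
have t0 : 0 <= t by rewrite divr_ge0// mulr_ge0 ?ltW// half_mean_gt0.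
have mD : measurable D by rewrite -[X in measurable X]setTI; exact: measurable_fst.
have iD : P.-integrable D (fun w => (mi ord0 w.1)%:E).
  by have [_ i _] := is_cond_exp_mi ord0; exact: (integrableS measurableT).
have iE : P.-integrable D (fun w => (2 * t)%:E * (mi ord0 w.1)%:E)%E.
  exact: integrableZl.
have iC : P.-integrable D (cst (t ^+ 2)%:E) by exact: finite_measure_integrable_cst.
apply: (@le_trans _ _ (\int[P]_(w in D) (mi ord0 w.1 ^+ 2)%:E)%E); last first.
  apply: ge0_subset_integral => //.
  - by apply/measurable_EFinP; apply: measurable_funX; exact: mmf.
  - by move=> w _; rewrite lee_fin sqr_ge0.
apply: (@le_trans _ _ (\int[P]_(w in D) ((2 * t)%:E * (mi ord0 w.1)%:E - cst (t ^+ 2)%:E w))%E); last first.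
  apply: le_integral => //.
  - exact: integrableB.
  - apply/integrableP; split.
      by apply/measurable_EFinP/measurable_funTS; apply: measurable_funX; exact: mmf.
    apply: le_lt_trans mi_sq_lty; under eq_integral do rewrite /= ger0_norm ?sqr_ge0//.
    apply: ge0_subset_integral => //.
    + by apply/measurable_EFinP; apply: measurable_funX; exact: mmf.
    + by move=> w _; rewrite lee_fin sqr_ge0.
  by move=> w _; rewrite -EFinM -EFinB lee_fin; have := sqr_ge0 (mi ord0 w.1 - t); nra.
rewrite integralB// integralZl// integral_cst//.
have PD1 : (P D <= 1)%E by exact: probability_le1.
apply: (@le_trans _ _ ((2 * t)%:E * t%:E - (t ^+ 2)%:E * 1)%E).
  rewrite mule1 -EFinM -EFinB lee_fin.
  by have -> : 2 * t * t - t ^+ 2 = (e0 / 2) ^+ 2 by rewrite /t; ring.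
apply: leeB.
  by apply: lee_wpmul2l; [rewrite lee_fin mulr_ge0|exact: int_mi_B].
by apply: lee_wpmul2l => //; rewrite lee_fin sqr_ge0.
Qed.

(** The matrix has a single nonzero entry, the variance of E[x_0 | y], which equals its second
    moment because the mean is 0. *)
Lemma gSNR_link : (e0 / 2) ^+ 2 <= gSNR P.
Proof.
pose ce i y := cond_exp P fst (fun w : R * X => tnth w.2 i) y.
have mce i : measurable_fun [set: R * X] (fun w => ce i w.1).
  exact: (measurableT_comp (measurable_cond_exp (is_cond_exp_mi i)) measurable_fst).
have ae i := cond_exp_ae measurable_fst (is_cond_exp_mi i).
have cov i j := ae_covariance (mce i) (mmf i) (mce j) (mmf j) (ae i) (ae j).
have cov0 i j : (i != ord0) || (j != ord0) ->
    covariance P (fun w => ce i w.1) (fun w => ce j w.1) = 0%E.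
  rewrite cov => /orP[] /mi_cst ->.
    by rewrite (_ : cst 0 \o fst = cst 0)// covariance_cst_l.
  by rewrite (_ : cst 0 \o fst = cst 0)// covariance_cst_r.
have covV : covariance P (fun w => ce ord0 w.1) (fun w => ce ord0 w.1) =
    (\int[P]_t (mi ord0 t.1 ^+ 2)%:E)%E.
  rewrite cov unlock mean_mi unlock; apply: eq_integral => w _.
  by rewrite !fctE/= subr0 expr2.
have sq0 : (0 <= \int[P]_t (mi ord0 t.1 ^+ 2)%:E)%E.
  by apply: integral_ge0 => w _; rewrite lee_fin sqr_ge0.
have sqfin : (\int[P]_t (mi ord0 t.1 ^+ 2)%:E)%E \is a fin_num.
  by rewrite ge0_fin_numE// mi_sq_lty.
rewrite /gSNR; set M := \matrix_(_, _) _.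
have M00 : M ord0 ord0 = fine (\int[P]_t (mi ord0 t.1 ^+ 2)%:E)%E.
  by rewrite mxE -covV.
apply: le_trans (lambda_max_corner _ _).
- by rewrite M00 -lee_fin fineK// mi_sq_ge.
- by rewrite M00 fine_ge0.
- by move=> i j ij; rewrite mxE -[covariance _ _ _]/(covariance P (fun w => ce i w.1) (fun w => ce j w.1)) cov0.
Qed.

End gSNR_bound.

(** * The lower bound *)

Section grid.
Context (R : realType) (h : R) (M : nat).
Definition grid_point (i : nat) : R := (i%:R - M%:R) * h.

(** The number of grid points not exceeding x. The 2M + 1 points run from -Mh to Mh, giving 2M + 2
    cells, the two outermost unbounded. *)
Definition grid_cell (x : R) : nat :=
  (\sum_(i < (M + M).+1) (grid_point i <= x)%R)%N.

Lemma grid_cell_lt x : (grid_cell x < (M + M).+2)%N.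
Proof.
rewrite ltnS /grid_cell -[leqRHS]card_ord -sum1_card leq_sum// => i _.
exact: leq_b1.
Qed.

Lemma grid_cell_homo x y : x <= y -> (grid_cell x <= grid_cell y)%N.
Proof.
move=> xy; apply: leq_sum => i _; have [gx|] := boolP (grid_point i <= x) => //.
by rewrite (le_trans gx xy).
Qed.

Lemma grid_cell_split x y i : (i < (M + M).+1)%N ->
  x < grid_point i -> grid_point i <= y -> (grid_cell x < grid_cell y)%N.
Proof.
move=> iM xi iy; have xy : x <= y by rewrite ltW// (lt_le_trans xi).
rewrite /grid_cell (bigD1 (Ordinal iM))//= [ltnRHS](bigD1 (Ordinal iM))//=.
rewrite leNgt xi iy/= add0n add1n ltnS; apply: leq_sum => j _.
by have [gx|] := boolP (grid_point j <= x) => //; rewrite (le_trans gx xy).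
Qed.

Lemma measurable_grid_cell : measurable_fun [set: R] grid_cell.
Proof.
have mE (j : nat) : measurable (grid_cell @^-1` [set j]).
  have -> : grid_cell @^-1` [set j] =
      (fun x => (grid_cell x)%:R : R) @^-1` [set j%:R].
    by apply/seteqP; split => x /= => [->//|/eqP]; rewrite eqr_nat => /eqP.
  rewrite -[X in measurable X]setTI.
  suff : measurable_fun [set: R] (fun x => (grid_cell x)%:R : R) by apply.
  under eq_fun do rewrite natr_sum.
  apply: measurable_sum => i.
  rewrite (_ : (fun x => _) = \1_(`[grid_point i, +oo[%classic)).
    by apply: measurable_indic; exact: measurable_itv.
  apply/funext => x; rewrite indicE; congr (nat_of_bool _)%:R.
  by apply/idP/idP; rewrite inE/= in_itv/= andbT.
move=> _ Y _; rewrite setTI.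
rewrite (_ : _ @^-1` Y = \bigcup_(j in Y) (grid_cell @^-1` [set j])).
  by apply: bigcup_measurable => j _; exact: mE.
by apply/seteqP; split => [x Yx|x [j Yj jx]]; [exists (grid_cell x)|rewrite /= jx].
Qed.

HB.instance Definition _ :=
  isMeasurableFun.Build _ _ _ _ grid_cell measurable_grid_cell.

Lemma grid_cell_ge0 x : 0 <= x -> (grid_cell 0 <= grid_cell x)%N.
Proof. exact: grid_cell_homo. Qed.

(** The point of index M is 0, so no cell contains both negative and nonnegative numbers. *)
Lemma grid_cell_lt0 x : x < 0 -> ~~ (grid_cell 0 <= grid_cell x)%N.
Proof.
move=> x0; have gM : grid_point M = 0 by rewrite /grid_point subrr mul0r.
by rewrite -ltnNge (@grid_cell_split _ _ M) ?gM// ltnS leq_addr.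
Qed.

(** Inside the grid, x lies between two consecutive grid points; moving by more than h crosses one
    of them and changes the count. *)
Lemma grid_cell_eq x y : grid_cell x = grid_cell y ->
  (M%:R * h <= `|x|) \/ (`|x - y| <= h).
Proof.
move=> xy; have [|xM] := leP (M%:R * h) `|x|; [by left|right].
rewrite leNgt; apply/negP => far.
move: xM; rewrite ltr_norml => /andP[xlo xhi].
have ex : exists i, x < grid_point i.
  by exists (M + M)%N; rewrite /grid_point natrD addrK.
pose i := ex_minn ex.
have [xi imin] : x < grid_point i /\ forall j, x < grid_point j -> (i <= j)%N.
  by rewrite /i; case: ex_minnP.
have iM : (i < (M + M).+1)%N.
  by rewrite ltnS imin// /grid_point natrD addrK.
have i0 : (0 < i)%N.
  rewrite lt0n; apply/eqP => i0; move: xi; rewrite i0 /grid_point sub0r mulNr.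
  by move=> /(lt_trans xlo); rewrite ltxx.
have ip : grid_point i.-1 <= x.
  rewrite leNgt; apply/negP => /imin; rewrite leqNgt; apply/negP/negPn.
  by rewrite prednK.
have iS : grid_point i = grid_point i.-1 + h.
  by rewrite /grid_point -{1}(prednK i0) -natr1; ring.
move: far; rewrite ltr_normr => /orP[yx|yx].
  have yi : y < grid_point i.-1 by lra.
  have ip' : (i.-1 < (M + M).+1)%N by rewrite (leq_ltn_trans (leq_pred _)).
  by have := grid_cell_split ip' yi ip; rewrite xy ltnn.
have iy : grid_point i <= y by lra.
by have := grid_cell_split iM xi iy; rewrite xy ltnn.
Qed.

End grid.

Section spectrum_scalar.
Context (R : realType) (p : nat) (c : R).

Lemma eigenvalue_scalar : [set b | eigenvalue (c%:M : 'M[R]_p.+1) b] = [set c].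
Proof.
apply/seteqP; split => b /=.
  move=> /eigenvalueP[v]; rewrite mul_mx_scalar => /eqP.
  rewrite -subr_eq0 -scalerBl scaler_eq0 subr_eq0 => /orP[/eqP //|/eqP ->].
  by rewrite eqxx.
move=> ->; apply/eigenvalueP; exists (delta_mx ord0 ord0).
  by rewrite mul_mx_scalar.
by apply/eqP => /matrixP/(_ ord0 ord0); rewrite !mxE eqxx => /eqP; rewrite oner_eq0.
Qed.

Lemma lambda_max_scalar : lambda_max (c%:M : 'M[R]_p.+1) = c.
Proof. by rewrite /lambda_max eigenvalue_scalar sup1. Qed.

Lemma lambda_min_scalar : lambda_min (c%:M : 'M[R]_p.+1) = c.
Proof. by rewrite /lambda_min eigenvalue_scalar inf1. Qed.

End spectrum_scalar.

(** * From acceptance probabilities to errors *)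

Section errors.
Context (R : realType) (p n : nat) (phi : n.-tuple (R * p.-tuple R)%type -> bool).
Hypothesis mphi : measurable_fun [set: n.-tuple (R * p.-tuple R)%type] phi.
Implicit Types P : probability (R * p.-tuple R)%type R.

Let mT b : measurable (phi @^-1` [set b]).
Proof. by rewrite -[X in measurable X]setTI; exact: mphi. Qed.

Lemma expect_reject P :
  ('E_(iid P n)[fun w => (phi w)%:R] = iid P n (phi @^-1` [set true]))%E.
Proof.
rewrite -expectation_indic//; congr expectation; apply/funext => w.
by rewrite indicE; congr (nat_of_bool _)%:R; apply/idP/idP; rewrite inE.
Qed.

Lemma expect_accept P :
  ('E_(iid P n)[fun w => (1 - (phi w)%:R)%R] = iid P n (phi @^-1` [set false]))%E.
Proof.
rewrite -expectation_indic//; congr expectation; apply/funext => w.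
rewrite indicE; case phiw: (phi w).
  by rewrite memNset ?subrr//= phiw.
by rewrite mem_set ?subr0.
Qed.

Lemma type1_ge (H0 : set (probability (R * p.-tuple R)%type R)) P : H0 P ->
  fine (iid P n (phi @^-1` [set true])) <= type1 phi H0.
Proof.
move=> HP; apply: ub_le_sup; last by exists P => //; rewrite expect_reject.
exists 1 => _ [Q _ <-]; rewrite expect_reject -lee_fin fineK ?probability_le1//.
exact: fin_num_measure.
Qed.

Lemma type2_ge (Ha : set (probability (R * p.-tuple R)%type R)) P : Ha P ->
  fine (iid P n (phi @^-1` [set false])) <= type2 phi Ha.
Proof.
move=> HP; apply: ub_le_sup; last by exists P => //; rewrite expect_accept.
exists 1 => _ [Q _ <-]; rewrite expect_accept -lee_fin fineK ?probability_le1//.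
exact: fin_num_measure.
Qed.

(** Type I error is at least 1 - P0(accept), type II error at least P1(accept), and the acceptance
    probabilities satisfy P0 <= P1 + 1/2. *)
Lemma errors_ge (H0 Ha : set (probability (R * p.-tuple R)%type R)) P0 P1 :
  H0 P0 -> Ha P1 ->
  (iid P0 n (phi @^-1` [set false]) <=
   iid P1 n (phi @^-1` [set false]) + (2^-1)%:E)%E ->
  2^-1 <= type1 phi H0 + type2 phi Ha.
Proof.
move=> HP0 HP1; have := type1_ge HP0; have := type2_ge HP1.
have -> : phi @^-1` [set true] = ~` (phi @^-1` [set false]).
  by apply/seteqP; split => w /=; case: (phi w).
rewrite probability_setC//.
have : iid P0 n (phi @^-1` [set false]) \is a fin_num by exact: fin_num_measure.
have : iid P1 n (phi @^-1` [set false]) \is a fin_num by exact: fin_num_measure.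
move: (iid P1 n _) (iid P0 n _) => [u||] [v||] //= _ _.
by rewrite -EFinD lee_fin; lra.
Qed.

End errors.

Section two_point.
Context (R : realType) (Cmin Cmax c : R) (F : set (R * R -> R)).
Hypotheses (c0 : 0 < c) (c_gt : Cmin < c) (c_lt : c < Cmax).
Hypothesis SIMaF : SIMa R `<=` F.
Variable p : nat.

Let a := Num.sqrt c.
Local Notation X := (p.+1.-tuple R).
Local Notation mu := (@gaussian R p.+1 (Num.sqrt c)%:M).

Let dot_e1 (x : X) : dot (delta_mx ord0 ord0) x = tnth x ord0.
Proof.
rewrite /dot (bigD1 ord0)//= big1 ?addr0 ?mxE ?eqxx ?mul1r//.
by move=> i i0; rewrite !mxE (negbTE i0) mul0r.
Qed.

Let mvnormal_mu : is_mvnormal c%:M mu.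
Proof.
have := is_mvnormal_gaussian (Num.sqrt c)%:M : is_mvnormal _ mu.
by rewrite tr_scalar_mx -scalar_mxM -expr2 sqr_sqrtr ?ltW.
Qed.

(** Used with [b = 0] and a zero link for the null, and with the first basis vector and a step link
    for the alternative. *)
Lemma single_index_noisy (g : {mfun R >-> R}) (h : {mfun X >-> R}) b s :
  0 < s -> (forall x, h x = g (dot b x)) ->
  single_index Cmin Cmax F b (noisy mu h s).
Proof.
move=> s0 hg; exists c%:M, mu, s, (fun ze => g ze.1 + ze.2); split.
- exact: mvnormal_mu.
- by rewrite lambda_min_scalar lambda_max_scalar.
- exact: s0.
- by apply: SIMaF; exists g => //; exact: measurable_funPT.
move=> B mB; have -> : (fun xe : X * R => (g (dot b xe.1) + xe.2, xe.1)) = noise_map h.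
  by apply/funext => -[x e]; rewrite /noise_map/= hg.
by [].
Qed.

Lemma null_laws_noisy s : 0 < s ->
  null_laws p.+1 Cmin Cmax F (noisy mu (cst 0) s).
Proof.
move=> s0; rewrite /null_laws/=.
by apply: (@single_index_noisy (cst 0) (cst 0) 0 s s0).
Qed.

Variables (k : {mfun R >-> nat}) (N : nat).
Hypothesis kN : forall x, (k x < N)%N.
Variables (pos : pred nat) (r : R).
Hypothesis pos_gt0 : forall x, 0 < x -> pos (k x).
Hypothesis pos_lt0 : forall x, x < 0 -> ~~ pos (k x).
Hypothesis tail_r : (normal_prob (0 : R) 1 [set e : R | (r <= `|e|)%R] <= (4^-1)%:E)%E.

Lemma alt_laws_noisy (G : N.-tuple R) s lam :
  collision_free (fun x y : R => `|x - y| <= r *+ 2) N G ->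
  (0 < s)%N -> lam <= (Num.sqrt c * half_mean R / 2) ^+ 2 ->
  alt_laws p.+1 Cmin Cmax F s lam (noisy mu (mlink (cell_ofN kN) G) 1).
Proof.
move=> Gsep s0 laml; exists (delta_mx ord0 ord0).
have e1 i : (delta_mx ord0 ord0 : 'rV[R]_p.+1) ord0 i = (i == ord0)%:R.
  by rewrite mxE; congr (nat_of_bool _)%:R; apply/andP/idP => [[]|].
split.
- rewrite /l2norm (bigD1 ord0)//= big1 => [|i i0]; last first.
    by rewrite e1 (negbTE i0) expr0n.
  by rewrite addr0 e1 eqxx expr1n sqrtr1.
- apply: leq_trans s0; rewrite -[leqRHS](cards1 (ord0 : 'I_p.+1)) subset_leq_card//.
  apply/fintype.subsetP => i; rewrite !inE e1.
  by case: (i == ord0) => //; rewrite eqxx.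
- have mg : measurable_fun [set: R] (link k G).
    by apply: (measurable_link1 kN).
  by apply: (@single_index_noisy (mlink kN G)) => [|x]; [exact: ltr01|rewrite dot_e1].
- apply: (le_trans laml).
  exact: (@gSNR_link R p c k N c0 kN G pos r pos_gt0 pos_lt0 tail_r Gsep).
Qed.

End two_point.

Section cell_probability.
Context (R : realType) (p : nat) (c h : R) (M : nat).
Hypotheses (c0 : 0 < c) (h0 : 0 < h).
Local Notation X := (p.+1.-tuple R).
Local Notation mu := (@gaussian R p.+1 (Num.sqrt c)%:M).
Local Notation k := (grid_cell h M : {mfun R >-> nat}).

Lemma noisy_snd d (Y : measurableType d) (nu : probability Y R) (f : {mfun Y >-> R})
    s E : measurable E -> noisy nu f s (snd @^-1` E) = nu E.
Proof.
move=> mE; rewrite /noisy /distribution /pushforward/=.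
rewrite (_ : _ @^-1` _ = E `*` setT); last first.
  by apply/seteqP; split => -[y e] //= [].
rewrite product_measure1E// [X in (_ * X)%E](_ : _ = 1%E) ?mule1//.
exact: probability_setT.
Qed.

(** By [grid_cell_eq], a point of the cell is either in the tail or within h of a fixed point of the
    cell; each event costs delta / 2. *)
Lemma gaussian_cell_le T delta : 0 < T -> T * Num.sqrt c <= M%:R * h ->
  (normal_prob (0 : R) 1 [set z : R | (T <= `|z|)%R] <= (delta / 2)%:E)%E ->
  h / Num.sqrt c *+ 2 * normal_peak 1 <= delta / 2 ->
  forall j, (mu [set x : X | k (tnth x ord0) = j] <= delta%:E)%E.
Proof.
move=> T0 TM tailT hd j; set a := Num.sqrt c in TM hd *.
have a0 : 0 < a by rewrite sqrtr_gt0.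
have mj : measurable (k @^-1` [set j]).
  by rewrite -[X in measurable X]setTI; exact: (measurable_funPT k).
(* A nonempty cell provides the reference point [b]; an empty one has probability 0. *)
have [Ej|/set0P[b bj]] := eqVneq (k @^-1` [set j]) set0.
  rewrite (_ : [set x | _] = set0) ?measure0.
    rewrite lee_fin -[delta](@divfK _ 2)// mulr_ge0//.
    by rewrite -lee_fin (le_trans _ tailT).
  rewrite -subset0 => x /= xj.
  by have : (k @^-1` [set j]) (tnth x ord0) by []; rewrite Ej.
pose phi : R -> R := \1_(k @^-1` [set j]).
have mphi : measurable_fun [set: R] phi by exact: measurable_indic.
have phi0 x : 0 <= phi x by rewrite /phi.
have mE : measurable [set x : X | k (tnth x ord0) = j].
  rewrite -[X in measurable X]setTI; exact: (measurable_tnth ord0 measurableT mj).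
have -> : mu [set x : X | k (tnth x ord0) = j] =
    (\int[mu]_x (phi (tnth x ord0))%:E)%E.
  transitivity (\int[mu]_x (\1_[set x : X | k (tnth x ord0) = j] x)%:E)%E.
    by rewrite integral_indic// setIT.
  by apply: eq_integral => x _; rewrite /phi !indicE.
rewrite (@gaussian_coord R p a phi ord0 mphi phi0).
have maz : measurable_fun [set: measurableTypeR R] (fun z : R => a * z).
  exact: measurable_funM.
have mD : measurable [set z : measurableTypeR R | k (a * z) = j].
  by have := maz measurableT _ mj; rewrite setTI.
have mI (f : R -> R) (i : interval R) : measurable_fun [set: R] f ->
    measurable (f @^-1` [set` i] : set R).
  by move=> mf; rewrite -[X in measurable X]setTI; apply: mf => //; exact: measurable_itv.
have mT : measurable [set z : R | T <= `|z|].
  rewrite (_ : [set z | _] = (fun z : R => `|z|) @^-1` `[T, +oo[%classic).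
    by apply: mI; exact: normr_measurable.
  by apply/seteqP; split => e /=; rewrite in_itv/= andbT.
have mb : measurable [set z : R | `|z - b / a| <= h / a].
  rewrite (_ : [set z | _] = (fun z : R => `|z - b / a|) @^-1` `]-oo, h / a]%classic).
    apply: mI; apply: measurableT_comp; first exact: normr_measurable.
    exact: measurable_funB.
  by apply/seteqP; split => e /=; rewrite in_itv/=.
have -> : (\int[normal_prob (0 : R) 1]_z (phi (a * z))%:E =
    normal_prob (0 : R) 1 [set z : measurableTypeR R | k (a * z)%R = j])%E.
  transitivity (\int[normal_prob (0 : R) 1]_z
      (\1_[set z : measurableTypeR R | k (a * z)%R = j] z)%:E)%E.
    by apply: eq_integral => x _; rewrite /phi !indicE.
  by rewrite integral_indic// setIT.
apply: (@le_trans _ _ (normal_prob (0 : R) 1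
    ([set z : R | T <= `|z|] `|` [set z : R | `|z - b / a| <= h / a]))).
  apply: le_measure; rewrite ?inE//; first exact: measurableU.
  move=> z /= zj; have /grid_cell_eq : grid_cell h M (a * z) = grid_cell h M b.
    by rewrite [LHS]zj.
  case=> [big|close]; [left|right] => /=.
    rewrite -(ler_pM2r a0) (le_trans TM)// (le_trans big)//.
    by rewrite normrM gtr0_norm// mulrC.
  rewrite ler_pdivlMr// -[X in _ * X]gtr0_norm// -normrM mulrBl divfK ?gt_eqF//.
  by rewrite mulrC.
apply: (le_trans (measureU2 (normal_prob (0 : R) 1) mT mb)).
rewrite [delta in leRHS](_ : _ = delta / 2 + delta / 2); last by field.
rewrite EFinD; apply: leeD => //.
apply: le_trans (normal_interval_le 0 (b / a) (oner_neq0 R) _) _.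
  by rewrite divr_ge0// ltW.
by rewrite lee_fin.
Qed.

End cell_probability.

Section lower_bound.
Context (R : realType) (Cmin Cmax c : R) (F : set (R * R -> R)).
Hypotheses (c0 : 0 < c) (c_gt : Cmin < c) (c_lt : c < Cmax).
Hypothesis SIMaF : SIMa R `<=` F.

Let v0 := (Num.sqrt c * half_mean R / 2) ^+ 2.

Lemma indistinguishable p n (A : set (n.-tuple (R * p.+1.-tuple R)%type)) s lam :
  measurable A -> (0 < s)%N -> lam <= v0 ->
  exists P0 P1, [/\ null_laws p.+1 Cmin Cmax F P0,
    alt_laws p.+1 Cmin Cmax F s lam P1 &
    (iid P0 n A <= iid P1 n A + (2^-1)%:E)%E].
Proof.
move=> mA s0 lamv; set a := Num.sqrt c; have a0 : 0 < a by rewrite sqrtr_gt0.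
have pk0 : 0 < normal_peak (1 : R) by rewrite normal_peak_gt0 ?oner_neq0.
have [r r0 tail_r] := @normal_tail_small R 4^-1 (ltac:(lra)).
(* Makes n^2 delta at most 1/8, the collision probability allowed to the sample; the added 1 covers
   n = 0. *)
pose delta : R := (8 * (n%:R ^+ 2 + 1))^-1.
have n1 : 0 < (n%:R ^+ 2 + 1 : R) by rewrite ltr_wpDl ?sqr_ge0.
have delta0 : 0 < delta by rewrite invr_gt0 mulr_gt0.
have [T T0 tailT] := @normal_tail_small R (delta / 2) (divr_gt0 delta0 (ltr0Sn _ 1)).
(* Turns the bound on an interval of radius h / a into exactly delta / 2. *)
pose h := a * delta / (4 * normal_peak 1).
have h0 : 0 < h by rewrite divr_gt0 ?mulr_gt0.
pose M := Num.bound (T * a / h).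
have TM : T * a <= M%:R * h.
  rewrite -ler_pdivrMr// ltW// archi_boundP// divr_ge0// ?ltW// mulr_gt0//.
have hd : h / a *+ 2 * normal_peak 1 <= delta / 2.
  rewrite le_eqVlt; apply/orP; left; apply/eqP; rewrite /h.
  by field; rewrite !gt_eqF.
pose k := grid_cell h M : {mfun R >-> nat}; pose N := (M + M).+2.
have kN x : (k x < N)%N by exact: grid_cell_lt.
have N1 : 0 < (N%:R ^+ 2 + 1 : R) by rewrite ltr_wpDl ?sqr_ge0.
pose d' : R := (8 * (N%:R ^+ 2 + 1))^-1.
have d'0 : 0 < d' by rewrite invr_gt0 mulr_gt0.
have r4 : 0 < r *+ 2 *+ 2 by rewrite !mulrn_wgt0.
(* Chosen last, since it depends on the number N of cells: an interval of radius 2r then has mass at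
   most d', and the N levels are separated except with probability 1/8. *)
have [sg sg0 peak] := normal_peak_small (divr_gt0 d'0 r4).
pose mu := @gaussian R p.+1 a%:M.
pose e (x y : measurableTypeR R) := `|x - y| <= r *+ 2.
pose S := collision_free e N.
have me : measurable_fun [set: measurableTypeR R * measurableTypeR R] (fun u => e u.1 u.2).
  apply: measurable_fun_ler => //; apply: measurableT_comp; first exact: normr_measurable.
  exact: measurable_funB.
have e_sym x y : e x y = e y x by rewrite /e distrC.
have eP y : (normal_prob (0 : R) sg [set x | e x y] <= d'%:E)%E.
  apply: le_trans (normal_interval_le 0 y (lt0r_neq0 sg0) _) _.
    by rewrite mulrn_wge0// ltW.
  by rewrite lee_fin mulrC -ler_pdivlMr// !mulrn_wgt0.
have mS : measurable S by exact: measurable_collision_free.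
have Sb : (iid (normal_prob (0 : R) sg) N (~` S) <= (8^-1)%:E)%E.
  apply: le_trans (collision_le me e_sym (ltW d'0) eP N) _.
  rewrite lee_fin /d' invfM mulrCA ler_piMr// ler_pdivrMr// mul1r; lra.
pose kappa := cell_of k : {mfun p.+1.-tuple R >-> nat}.
pose Q0 := noisy mu (cst 0) (tau sg).
have scP t' : (Q0 [set t | same_cell kappa t t'] <= delta%:E)%E.
  have -> : [set t | same_cell kappa t t'] =
      snd @^-1` [set x : p.+1.-tuple R | k (tnth x ord0) = kappa t'.2].
    by apply/seteqP; split => t /= /eqP.
  have mj : measurable [set x : p.+1.-tuple R | k (tnth x ord0) = kappa t'.2].
    by have := @measurable_cell_of R p k measurableT [set kappa t'.2]; rewrite setTI; apply.
  rewrite [X in (X <= _)%E](noisy_snd mu (cst 0) (tau sg) mj).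
  exact: (gaussian_cell_le p c0 h0 T0 TM tailT hd).
have Qb : (iid Q0 n (~` collision_free (same_cell kappa) n) <= (8^-1)%:E)%E.
  apply: le_trans (collision_le (measurable_same_cell kappa) _ (ltW delta0) scP n) _.
    by move=> t t'; rewrite /same_cell eq_sym.
  rewrite lee_fin /delta invfM mulrCA ler_piMr// ler_pdivrMr// mul1r; lra.
have [G SG AG] : exists2 G, S G & (iid Q0 n A <=
    iid (noisy mu (mlink (cell_ofN kN) G) 1) n A + (2^-1)%:E)%E.
  apply: exists_fooling_link => //; first lra.
  apply: le_lt_trans (leeD Qb Sb) _.
  by rewrite -EFinD lte_fin; lra.
exists Q0, (noisy mu (mlink (cell_ofN kN) G) 1); split => //.
- by apply: null_laws_noisy => //; rewrite lt0r tau_neq0 sqrtr_ge0.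
- apply: (@alt_laws_noisy R Cmin Cmax c F c0 c_gt c_lt SIMaF p k N kN
    (fun j => (grid_cell h M 0 <= j)%N) r _ _ tail_r G s lam) => //.
  + by move=> x x0; apply: grid_cell_ge0; exact: ltW.
  + by move=> x x0; apply: grid_cell_lt0.
Qed.

Lemma errors_ge_half p n s lam
    (phi : n.-tuple (R * p.-tuple R)%type -> bool) :
  (0 < p)%N -> (0 < s)%N -> lam <= v0 -> measurable_fun [set: _] phi ->
  2^-1 <= type1 phi (null_laws p Cmin Cmax F) +
          type2 phi (alt_laws p Cmin Cmax F s lam).
Proof.
case: p phi => // p phi _ s0 lamv mphi.
have mA : measurable (phi @^-1` [set false]).
  by rewrite -[X in measurable X]setTI; exact: mphi.
have [P0 [P1 [H0 Ha le]]] := indistinguishable mA s0 lamv.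
exact: (errors_ge mphi H0 Ha le).
Qed.

(** If both errors tended to 0, at some n each would be below 1/4, against the bound 1/2 on their
    sum. *)
Lemma not_separable (p s : nat -> nat) (lam : nat -> R) :
  (\forall n \near \oo, [/\ (0 < p n)%N, (0 < s n)%N & lam n <= v0]) ->
  ~ separable (fun n => null_laws (p n) Cmin Cmax F)
              (fun n => alt_laws (p n) Cmin Cmax F (s n) (lam n)).
Proof.
move=> ev [phi [mphi cv1 cv2]].
have q0 : (0 : R) < 4^-1 by lra.
have ev1 : \forall n \near \oo, type1 (phi n) (null_laws (p n) Cmin Cmax F) < 4^-1.
  exact: (cvgr_lt _ cv1).
have ev2 : \forall n \near \oo,
    type2 (phi n) (alt_laws (p n) Cmin Cmax F (s n) (lam n)) < 4^-1.
  exact: (cvgr_lt _ cv2).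
have [n [[pn sn ln] [t1 t2]]] := filter_ex (filterI ev (filterI ev1 ev2)).
have := errors_ge_half pn sn ln (mphi n).
by lra.
Qed.

End lower_bound.

Lemma SIMa_sub_SIM (R : realType) : SIMa R `<=` SIM R.
Proof.
move=> f [g mg ->]; apply: measurable_funD => //.
exact: measurableT_comp.
Qed.

(** * Consequences of the rate hypotheses *)

Section rates.
Context (R : realType) (p s n : nat) (l v : R).
Hypotheses (l0 : 0 < l) (v0 : 0 < v).
Local Notation A := (s%:R * ln p%:R / n%:R : R).
Local Notation B := (Num.sqrt p%:R / n%:R : R).

Lemma ln_nat_ge0 (m : nat) : 0 <= ln (m%:R : R).
Proof.
case: m => [|m]; first by rewrite ln0.
by rewrite ln_ge0// ler1n.
Qed.

Lemma sparse_rate_ge0 : 0 <= A.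
Proof. by rewrite divr_ge0// mulr_ge0// ln_nat_ge0. Qed.

(** A positive [l] forces a positive rate, which excludes s = 0 and, as ln 0 is 0 here, p = 0. *)
Lemma rate_pos (g : R) : l <= v * `|g| -> 0 <= g -> g <= A ->
  [/\ 0 < g, (0 < p)%N & (0 < s)%N].
Proof.
move=> lg g0 gA; have gp : 0 < g.
  rewrite lt0r g0 andbT; apply/eqP => gz; move: lg.
  by rewrite gz normr0 mulr0 leNgt l0.
split => //; rewrite lt0n; apply/eqP => z; move: (lt_le_trans gp gA).
  by rewrite z ln0// mulr0 mul0r ltxx.
by rewrite z !mul0r ltxx.
Qed.

Lemma rate_le1 (g : R) : l <= v * `|g| -> 0 <= g -> g <= 1 -> l <= v.
Proof.
move=> lg g0 g1; apply: (le_trans lg).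
by rewrite ger0_norm// ler_piMr// ltW.
Qed.

(** Squaring, (n g)^2 is at most both s^2 ln^2 p and p, hence at most n; so g is at most 1 / sqrt
    n. *)
Lemma min_rate_le1 :
  `|Num.min (s%:R ^+ 2 * ln p%:R ^+ 2) p%:R| <= 1 * `|n%:R : R| ->
  Num.min A B <= 1.
Proof.
rewrite mul1r [`|n%:R|]ger0_norm// => mn; set g := Num.min A B.
(* Division by zero yields 0, so the rate is 0 at n = 0. *)
have [nz|n0] := eqVneq n 0%N.
  by rewrite /g nz ge_min invr0 mulr0 ler01.
have np : 0 < (n%:R : R) by rewrite ltr0n lt0n.
have g0 : 0 <= g by rewrite le_min sparse_rate_ge0 divr_ge0 ?sqrtr_ge0.
have gA : n%:R * g <= s%:R * ln p%:R.
  by rewrite mulrC -ler_pdivlMr// /g ge_min lexx.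
have gB : n%:R * g <= Num.sqrt p%:R.
  by rewrite mulrC -ler_pdivlMr// /g ge_min lexx orbT.
have ng0 : 0 <= n%:R * g by rewrite mulr_ge0.
have sq : (n%:R * g) ^+ 2 <= n%:R.
  apply: le_trans mn; apply: le_trans (ler_norm _); rewrite le_min; apply/andP; split.
    by rewrite -exprMn ler_sqr ?nnegrE// (le_trans ng0).
  by rewrite -[leRHS]sqr_sqrtr// ler_sqr ?nnegrE ?sqrtr_ge0.
have n1 : 1 <= (n%:R : R) by rewrite ler1n lt0n.
rewrite leNgt; apply/negP => g1.
have nx : n%:R < n%:R * g by rewrite ltr_pMr.
move: (n%:R * g) nx sq => x nx sq; have x1 : 1 < x by exact: le_lt_trans nx.
nra.
Qed.

End rates.

Theorem corollary1 (R : realType) (Cmin Cmax : R) (Cmin_gt0 : 0 < Cmin)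
    (Cmin_lt_Cmax : Cmin < Cmax) (p s : nat -> nat) (lam : nat -> R)
    (lam_gt0 : forall n, 0 < lam n) :
  ((fun n => Num.min ((s n)%:R ^+ 2 * ln (p n)%:R ^+ 2) (p n)%:R : R)
     =o_\oo (fun n => n%:R : R) ->
   lam =o_\oo (fun n => Num.min ((s n)%:R * ln (p n)%:R / n%:R)
                                (Num.sqrt (p n)%:R / n%:R) : R) ->
   ~ separable (fun n => null_laws (p n) Cmin Cmax (SIM R))
               (fun n => alt_laws (p n) Cmin Cmax (SIM R) (s n) (lam n)))
  /\
  (lam =o_\oo (fun n => Num.min (Num.min ((s n)%:R * ln (p n)%:R / n%:R)
                                         (Num.sqrt (p n)%:R / n%:R))
                                (1 / Num.sqrt n%:R) : R) ->
   ~ separable (fun n => null_laws (p n) Cmin Cmax (SIMa R))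
               (fun n => alt_laws (p n) Cmin Cmax (SIMa R) (s n) (lam n))).
Proof.
(* The covariance c I must have its only eigenvalue strictly between the two bounds; any such fixed
   value would do. *)
pose c := (Cmin + Cmax) / 2.
have c_gt : Cmin < c by rewrite /c; lra.
have c_lt : c < Cmax by rewrite /c; lra.
have c0 : 0 < c by apply: lt_trans c_gt.
pose v0 := (Num.sqrt c * half_mean R / 2) ^+ 2.
have v0_gt0 : 0 < v0.
  by rewrite exprn_gt0// divr_gt0// mulr_gt0 ?half_mean_gt0// sqrtr_gt0.
split.
  move=> /eqoP /(_ _ ltr01) small /eqoP /(_ _ v0_gt0) lam_small.
  apply: (not_separable c0 c_gt c_lt (@SIMa_sub_SIM R)).
  apply: filterS2 small lam_small => n small_n.
  rewrite [`|lam n|]ger0_norm ?(ltW (lam_gt0 n))// => lam_n.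
  have g0 : 0 <= Num.min ((s n)%:R * ln (p n)%:R / n%:R)
      (Num.sqrt (p n)%:R / n%:R) :> R.
    by rewrite le_min sparse_rate_ge0 divr_ge0 ?sqrtr_ge0.
  have gA : Num.min ((s n)%:R * ln (p n)%:R / n%:R)
      (Num.sqrt (p n)%:R / n%:R) <= (s n)%:R * ln (p n)%:R / n%:R :> R.
    by rewrite ge_min lexx.
  have [_ pn sn] := rate_pos (lam_gt0 n) lam_n g0 gA.
  split => //; exact: (rate_le1 v0_gt0 lam_n g0 (min_rate_le1 small_n)).
move=> /eqoP /(_ _ v0_gt0) lam_small.
apply: (not_separable c0 c_gt c_lt (@subset_refl _ (SIMa R))).
apply: filterS lam_small => n.
rewrite [`|lam n|]ger0_norm ?(ltW (lam_gt0 n))//.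
set g := Num.min _ _ => lam_n.
have g0 : 0 <= g.
  by rewrite !le_min sparse_rate_ge0 !divr_ge0 ?sqrtr_ge0.
have gA : g <= (s n)%:R * ln (p n)%:R / n%:R by rewrite !ge_min lexx.
have g1 : g <= 1.
  rewrite (@le_trans _ _ (1 / Num.sqrt n%:R))//; first by rewrite ge_min lexx orbT.
  case: (posnP n) => [->|n_gt0]; first by rewrite sqrtr0 invr0 mulr0.
  rewrite ler_pdivrMr ?sqrtr_gt0 ?ltr0n// mul1r -[leLHS]sqrtr1 ler_wsqrtr//.
  by rewrite ler1n.
have [_ pn sn] := rate_pos (lam_gt0 n) lam_n g0 gA.
split => //; exact: (rate_le1 v0_gt0 lam_n g0 g1).
Qed.
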